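(* Let $A$ be a $3\times3$ indecomposable elemental admissible matrix (with parity $p$) having a singular isotropic index, and suppose $\mathfrak g(A)$ has finite growth. Then, after reordering indices and multiplying rows by nonzero scalars, $(A,p)$ is one of: $S(1,2,0)$: $A=\begin{pmatrix}0&0&1\\-1&2&-1\\1&-2&0\end{pmatrix}$, $p=(1,0,1)$; or $D(2,1,0)$: $A=\begin{pmatrix}0&0&1\\-1&2&0\\-1&0&2\end{pmatrix}$, $p=(1,0,0)$.
   Context: Let $I=\{1,\dots,n\}$, let $A=(a_{ij})_{i,j\in I}$ be a complex $n\times n$ matrix and $p:I\to\mathbb Z_2$ a parity function. Fix a complex vector space $\mathfrak h$ of dimension $n+\operatorname{corank}(A)$, linearly independent $\alpha_1,\dots,\alpha_n\in\mathfrak h^*$ and $h_1,\dots,h_n\in\mathfrak h$ with $\alpha_j(h_i)=a_{ij}$. Let $\bar{\mathfrak g}(A)$ be the Lie superalgebra generated by $\mathfrak h$ (even, abelian) and elements $X_i,Y_i$ ($i\in I$) of parity $p(i)$ subject to $[h,X_i]=\alpha_i(h)X_i$, $[h,Y_i]=-\alpha_i(h)Y_i$, $[X_i,Y_j]=\delta_{ij}h_i$. The contragredient Lie superalgebra $\mathfrak g(A)$ is the quotient of $\bar{\mathfrak g}(A)$ by the unique maximal ideal meeting $\mathfrak h$ trivially. Finite growth: $\dim\mathfrak g_m$ in the principal grading ($\deg X_i=1,\deg Y_i=-1,\deg\mathfrak h=0$) is polynomially bounded. $A$ is elemental if it has no zero row; indecomposable if $I$ is not a disjoint union of nonempty $J,K$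 with $a_{jk}=a_{kj}=0$ for $j\in J,k\in K$. Conditions (C1)–(C4): (C1) $a_{ii}\in\{0,2\}$; (C2) $a_{ii}=0\Rightarrow p(i)=1$; (C3) $a_{ii}=2\Rightarrow a_{ij}\in2^{p(i)}\mathbb Z_{\le0}$ for $j\neq i$; (C4) $a_{ij}=0$ and $a_{ji}\neq0$ $\Rightarrow a_{ii}=0$. Odd reflection: an index $k$ with $a_{kk}=0$, $p(k)=1$ is called isotropic; it is regular if for all $j\neq k$, $a_{kj}=0\Rightarrow a_{jk}=0$, and singular otherwise. The odd reflection at an isotropic $k$ produces $(A',p')$ defined, for $i,j\ne k$, by $a'_{kk}=a_{kk}$, $a'_{kj}=a_{kj}$, $a'_{ik}=-a_{ki}a_{ik}$, and $a'_{ij}=a_{ij}$ if $a_{ik}=a_{ki}=0$; $a'_{ij}=a_{ki}a_{ij}$ if ($a_{ik}\ne0$ or $a_{ki}\neq0$) and $a_{kj}=a_{jk}=0$; $a'_{ij}=a_{ki}a_{ij}+a_{kj}a_{ik}+a_{ki}a_{ik}$ if ($a_{ik}\ne0$ or $a_{ki}\ne 0$) and ($a_{jk}\ne0$ or $a_{kj}\ne0$); parities $p'(k)=1$, $p'(i)=p(i)+1$ if $a_{ik}\ne0$ or $a_{ki}\ne0$, and $p'(i)=p(i)$ otherwise; $A'$ is considered up to multiplying rows by nonzero scalars (normalized so that nonzero diagonal entries equal $2$). $A$ with $a_{ii}\in\{0,2\}$ is admissible if $A$ and every matrix obtained from $A$ by a finite sequence of odd reflections (regular or singular) satisfies (C1)–(C4).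 *)

(* Defs.v *)
From HB Require Import structures.
From mathcomp Require Import all_boot all_order all_algebra all_fingroup.
Set Implicit Arguments. Unset Strict Implicit. Unset Printing Implicit Defensive.
Import Order.TTheory GRing.Theory Num.Theory.
Local Open Scope ring_scope.

Section CartanData.
Variables (F : fieldType) (n : nat).
Implicit Types (A : 'M[F]_n) (p : 'I_n -> bool).

(* ---- Basic conditions on (A,p); p i = true means odd parity ---- *)
Definition elemental A : Prop := forall i : 'I_n, exists j, A i j != 0.

Definition indecomposable A : Prop :=
  forall J : {set 'I_n}, J != set0 -> J != setT ->
    exists j k, [/\ j \in J, k \notin J & (A j k != 0) || (A k j != 0)].

Definition isotropic A p (k : 'I_n) : Prop := A k k = 0 /\ p k = true.

Definition regular_isotropic A p k : Prop :=
  isotropic A p k /\ forall j, j != k -> A k j = 0 -> A j k = 0.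

Definition singular_isotropic A p k : Prop :=
  isotropic A p k /\ exists j, [/\ j != k, A k j = 0 & A j k != 0].

Definition C1 A : Prop := forall i, A i i = 0 \/ A i i = 2.
Definition C2 A p : Prop := forall i, A i i = 0 -> p i = true.
Definition C3 A p : Prop := forall i, A i i = 2 -> forall j, j != i ->
  exists z : nat, A i j = - ((2 ^ (p i : nat) * z)%N)%:R.
Definition C4 A : Prop := forall i j, A i j = 0 -> A j i != 0 -> A i i = 0.

Definition oref_raw A (k : 'I_n) : 'M[F]_n := \matrix_(i, j)
  if i == k then A k j
  else if j == k then - (A k i * A i k)
  else if (A i k == 0) && (A k i == 0) then A i j
  else if (A k j == 0) && (A j k == 0) then A k i * A i j
  else A k i * A i j + A k j * A i k + A k i * A i k.

Definition normalize_rows (B : 'M[F]_n) : 'M[F]_n := \matrix_(i, j)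
  if B i i == 0 then B i j else (2 / B i i) * B i j.

Definition odd_refl A (k : 'I_n) : 'M[F]_n := normalize_rows (oref_raw A k).

Definition odd_refl_par A p (k : 'I_n) : 'I_n -> bool := fun i =>
  if i == k then true
  else if (A i k != 0) || (A k i != 0) then ~~ p i else p i.

Inductive reachable A p : 'M[F]_n -> ('I_n -> bool) -> Prop :=
| reach_refl : reachable A p A p
| reach_step B q k : reachable A p B q -> isotropic B q k ->
    reachable A p (odd_refl B k) (odd_refl_par B q k).

Definition admissible A p : Prop :=
  C1 A /\ forall B q, reachable A p B q -> [/\ C1 B, C2 B q, C3 B q & C4 B].

End CartanData.

(* ---- Lie superalgebras (parity given by an involution par, char 0) ---- *)
Section LieSuper.
Variables (F : fieldType) (L : lmodType F).

Definition homog (par : L -> L) (b : bool) (x : L) : Prop :=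
  par x = (-1) ^+ b *: x.

Definition is_lie_superalgebra (br : L -> L -> L) (par : L -> L) : Prop :=
  (forall a x y z, br (a *: x + y) z = a *: br x z + br y z) /\
  (forall a x y z, br x (a *: y + z) = a *: br x y + br x z) /\
  (forall a x y, par (a *: x + y) = a *: par x + par y) /\
  (forall x, par (par x) = x) /\
  (forall x y, par (br x y) = br (par x) (par y)) /\
  (forall b c x y, homog par b x -> homog par c y ->
      br x y = - ((-1) ^+ (b && c) *: br y x)) /\
  (forall b c x y z, homog par b x -> homog par c y ->
      br x (br y z) = br (br x y) z + (-1) ^+ (b && c) *: br y (br x z)).

Variables (n m : nat) (br : L -> L -> L) (iota : 'rV[F]_m -> L)
  (X Y : 'I_n -> L).

Inductive princ_deg : int -> L -> Prop :=
| pd_h u : princ_deg 0 (iota u)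
| pd_X i : princ_deg 1 (X i)
| pd_Y i : princ_deg (-1) (Y i)
| pd_br a b x y : princ_deg a x -> princ_deg b y -> princ_deg (a + b) (br x y).

End LieSuper.

Definition span_dim_le (F : fieldType) (L : lmodType F) (S : L -> Prop) (N : nat)
  : Prop :=
  forall v : 'I_N.+1 -> L, (forall i, S (v i)) ->
    exists c : 'I_N.+1 -> F, (exists i, c i != 0) /\ \sum_i c i *: v i = 0.

(* (L, br, par, iota, X, Y) is the contragredient Lie superalgebra g(A)
   for the realization (m = n + corank A, alpha, hv): alpha_j(u) = (u *m alpha) 0 j,
   h_i = row i hv. *)
Definition is_contragredient (F : fieldType) (n : nat) (A : 'M[F]_n)
  (p : 'I_n -> bool) (m : nat) (alpha : 'M[F]_(m, n)) (hv : 'M[F]_(n, m))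
  (L : lmodType F) (br : L -> L -> L) (par : L -> L)
  (iota : 'rV[F]_m -> L) (X Y : 'I_n -> L) : Prop :=
  m = (n + (n - \rank A))%N /\ \rank alpha = n /\ hv *m alpha = A /\
      is_lie_superalgebra br par /\
      ((forall a u v, iota (a *: u + v) = a *: iota u + iota v)
        /\ (forall u, iota u = 0 -> u = 0)) /\
      [/\ forall u, par (iota u) = iota u,
          forall i, par (X i) = (-1) ^+ (p i) *: X i &
          forall i, par (Y i) = (-1) ^+ (p i) *: Y i] /\
      [/\ forall u v, br (iota u) (iota v) = 0,
          forall u i, br (iota u) (X i) = (u *m alpha) 0 i *: X i,
          forall u i, br (iota u) (Y i) = - ((u *m alpha) 0 i) *: Y i &
          forall i j, br (X i) (Y j) = if i == j then iota (row i hv) else 0] /\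
      (forall S : L -> Prop,
          (forall x y, S x -> S y -> S (x + y)) ->
          (forall a x, S x -> S (a *: x)) ->
          (forall x y, S x -> S y -> S (br x y)) ->
          (forall u, S (iota u)) -> (forall i, S (X i)) -> (forall i, S (Y i)) ->
          forall x, S x) /\
      (forall I : L -> Prop,
          I 0 ->
          (forall x y, I x -> I y -> I (x + y)) ->
          (forall a x, I x -> I (a *: x)) ->
          (forall x y, I y -> I (br x y) /\ I (br y x)) ->
          (forall u, I (iota u) -> iota u = 0) ->
          forall x, I x -> x = 0).

Definition contragredient_finite_growth (F : fieldType) (n : nat)
  (A : 'M[F]_n) (p : 'I_n -> bool) : Prop :=
  exists (m : nat) (alpha : 'M[F]_(m, n)) (hv : 'M[F]_(n, m))
         (L : lmodType F) (br : L -> L -> L) (par : L -> L)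
         (iota : 'rV[F]_m -> L) (X Y : 'I_n -> L),
    is_contragredient A p alpha hv br par iota X Y /\
    exists C d : nat, forall k : int,
      span_dim_le (princ_deg br iota X Y k) (C * (absz k + 1) ^ d)%N.

Definition equiv_reorder_rescale (F : fieldType) (n : nat)
  (A : 'M[F]_n) (p : 'I_n -> bool) (B : 'M[F]_n) (q : 'I_n -> bool) : Prop :=
  exists (s : 'S_n) (c : 'I_n -> F),
    [/\ forall i, c i != 0,
        forall i j, B i j = c i * A (s i) (s j) &
        forall i, q i = p (s i)].

Definition mx3 (F : fieldType) (l : seq (seq F)) : 'M[F]_3 :=
  \matrix_(i < 3, j < 3) nth 0 (nth [::] l i) j.

Definition par3 (l : seq bool) : 'I_3 -> bool := fun i => nth false l i.

Definition S120 (F : fieldType) : 'M[F]_3 :=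
  mx3 [:: [:: 0; 0; 1]; [:: -1; 2; -1]; [:: 1; -2; 0]].
Definition pS120 : 'I_3 -> bool := par3 [:: true; false; true].

Definition D210 (F : fieldType) : 'M[F]_3 :=
  mx3 [:: [:: 0; 0; 1]; [:: -1; 2; 0]; [:: -1; 0; 2]].
Definition pD210 : 'I_3 -> bool := par3 [:: true; false; false].

(* Main.v *)
(** The singular index, the index [j] witnessing its singularity, and the third
    index are called 1, 2, 3 here.  After the reflection at 1 the second diagonal entry
    vanishes, so (C2) forces index 2 to be even and non-isotropic.  If [a_33 = 0],
    the integrality conditions along the reflections 1; 3; 3,2; 3,2,1 leave only
    S(1,2,0).  If [a_33 = 2], the reflections 1; 1,3 leave the matrices
    [[0,0,1],[-b,2,0],[-1,0,2]] with [b] a positive integer, all of which satisfy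
    (C1)-(C4) along these reflections; for [b = 1] this is D(2,1,0).

    For [b >= 2] put [u_i = ad(X_2)^i X_1] and [v_i = ad(Y_2)^i Y_1].  These span an
    odd Heisenberg superalgebra [[u_i, v_j] = delta_ij c_i h_1] with
    [c_0, c_1, c_2 <> 0].  The vectors [w_ij = [u_i, [u_j, X_3]]] with [i < j <= 2] and
    the analogous vectors built from [v] and [Y_3] pair to [delta (h_3 - 2 h_1)] up to
    a nonzero scalar, and [h_3 - 2 h_1] acts on every [w_ij] by [-2], so that the [w_ij]
    behave like free generators.  With [x = w_01], [y = w_02], [z = w_12], the brackets of
    distinct vectors [ad(x)^(2 i) y] applied to [z] are linearly independent, and there
    are [2^m] of them in one degree quadratic in [m]: growth is not polynomial. *)

Require Import Defs.
From HB Require Import structures.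
From mathcomp Require Import all_boot all_order all_algebra all_fingroup.
From mathcomp Require Import zify ring.
Import GRing.Theory.
Local Open Scope ring_scope.

Set Implicit Arguments.
Unset Strict Implicit.
Unset Printing Implicit Defensive.

(** * Calculus of brackets and parities in a Lie superalgebra *)

Section LieSuperalgebra.
Variables (F : fieldType) (L : lmodType F) (br : L -> L -> L) (par : L -> L).
Hypothesis LS : is_lie_superalgebra br par.

Lemma br_linl a x y z : br (a *: x + y) z = a *: br x z + br y z.
Proof. by case: LS. Qed.

Lemma br_linr a x y z : br x (a *: y + z) = a *: br x y + br x z.
Proof. by case: LS => _ []. Qed.

Lemma par_lin a x y : par (a *: x + y) = a *: par x + par y.
Proof. by case: LS => _ [_ []]. Qed.

Lemma parK x : par (par x) = x.
Proof. by case: LS => _ [_ [_ []]]. Qed.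

Lemma par_br x y : par (br x y) = br (par x) (par y).
Proof. by case: LS => _ [_ [_ [_ []]]]. Qed.

Lemma br_sym b c x y : homog par b x -> homog par c y ->
  br x y = - ((-1) ^+ (b && c) *: br y x).
Proof. by case: LS => _ [_ [_ [_ [_ [h _]]]]]; apply: h. Qed.

Lemma br_jac b c x y z : homog par b x -> homog par c y ->
  br x (br y z) = br (br x y) z + (-1) ^+ (b && c) *: br y (br x z).
Proof. by case: LS => _ [_ [_ [_ [_ [_ h]]]]]; apply: h. Qed.

Lemma brDl x y z : br (x + y) z = br x z + br y z.
Proof. by rewrite -[x]scale1r br_linl !scale1r. Qed.

Lemma brDr x y z : br x (y + z) = br x y + br x z.
Proof. by rewrite -[y]scale1r br_linr !scale1r. Qed.

Lemma br0l x : br 0 x = 0.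
Proof. by apply: (addrI (br 0 x)); rewrite -brDl !addr0. Qed.

Lemma br0r x : br x 0 = 0.
Proof. by apply: (addrI (br x 0)); rewrite -brDr !addr0. Qed.

Lemma brZl a x y : br (a *: x) y = a *: br x y.
Proof. by rewrite -[a *: x]addr0 br_linl br0l addr0. Qed.

Lemma brZr a x y : br x (a *: y) = a *: br x y.
Proof. by rewrite -[a *: y]addr0 br_linr br0r addr0. Qed.

Lemma brNl x y : br (- x) y = - br x y.
Proof. by rewrite -scaleN1r brZl scaleN1r. Qed.

Lemma brNr x y : br x (- y) = - br x y.
Proof. by rewrite -scaleN1r brZr scaleN1r. Qed.

Lemma brBl x y z : br (x - y) z = br x z - br y z.
Proof. by rewrite brDl brNl. Qed.

Lemma brBr x y z : br x (y - z) = br x y - br x z.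
Proof. by rewrite brDr brNr. Qed.

Lemma parD x y : par (x + y) = par x + par y.
Proof. by rewrite -[x]scale1r par_lin !scale1r. Qed.

Lemma par0 : par 0 = 0.
Proof. by apply: (addrI (par 0)); rewrite -parD !addr0. Qed.

Lemma parZ a x : par (a *: x) = a *: par x.
Proof. by rewrite -[a *: x]addr0 par_lin par0 addr0. Qed.

Lemma homog_br b c x y :
  homog par b x -> homog par c y -> homog par (b (+) c) (br x y).
Proof.
rewrite /homog par_br => -> ->; rewrite brZl brZr scalerA.
by case: b c => [] []; rewrite ?mulrNN ?mulr1 ?mul1r.
Qed.

Lemma homogZ b a x : homog par b x -> homog par b (a *: x).
Proof. by rewrite /homog parZ => ->; rewrite !scalerA mulrC. Qed.

Lemma homogD b x y : homog par b x -> homog par b y -> homog par b (x + y).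
Proof. by rewrite /homog parD => -> ->; rewrite scalerDr. Qed.

Lemma jacE b c x y z : b && c = false -> homog par b x -> homog par c y ->
  br x (br y z) = br (br x y) z + br y (br x z).
Proof. by move=> bc hx hy; rewrite (br_jac z hx hy) bc scale1r. Qed.

Lemma jacO x y z : homog par true x -> homog par true y ->
  br x (br y z) = br (br x y) z - br y (br x z).
Proof. by move=> hx hy; rewrite (br_jac z hx hy) scaleN1r. Qed.

Lemma symE b c x y : b && c = false -> homog par b x -> homog par c y ->
  br x y = - br y x.
Proof. by move=> bc hx hy; rewrite (br_sym hx hy) bc scale1r. Qed.

Lemma symO x y : homog par true x -> homog par true y -> br x y = br y x.
Proof. by move=> hx hy; rewrite (br_sym hx hy) scaleN1r opprK. Qed.

End LieSuperalgebra.

(** * Exponentially many linearly independent brackets *)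

Section FreeGrowth.
Variables (F : fieldType) (L : lmodType F) (br : L -> L -> L) (par : L -> L).
Hypothesis LS : is_lie_superalgebra br par.
Hypothesis charF0 : [pchar F] =i pred0.
Variables x y z f g h : L.
Hypotheses (ex : homog par false x) (ey : homog par false y)
  (ef : homog par false f) (eg : homog par false g) (eh : homog par false h).
Hypotheses (fx : br f x = h) (gy : br g y = h) (fy : br f y = 0)
  (gx : br g x = 0) (fz : br f z = 0) (gz : br g z = 0).
Hypotheses (hx : br h x = x) (hy : br h y = y) (hz : br h z = z)
  (hf : br h f = - f) (hg : br h g = - g).
Hypothesis z_neq0 : z != 0.

Let natF_neq0 n : (0 < n)%N -> n%:R != 0 :> F.
Proof. by rewrite ((pcharf0P F).1 charF0) lt0n. Qed.

Let yy i := iter i (br x) y.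
Let gg j := iter j (br f) g.

Let xx : br x x = 0.
Proof.
have := symE LS (erefl : false && false = false) ex ex.
move/eqP; rewrite -addr_eq0 -mulr2n -scaler_nat scaler_eq0 (negPf (natF_neq0 _)) //.
by move/eqP.
Qed.

Let ff : br f f = 0.
Proof.
have := symE LS (erefl : false && false = false) ef ef.
move/eqP; rewrite -addr_eq0 -mulr2n -scaler_nat scaler_eq0 (negPf (natF_neq0 _)) //.
by move/eqP.
Qed.

Let eyy i : homog par false (yy i).
Proof. by elim: i => //= i IH; apply: (homog_br LS ex IH). Qed.

Let egg i : homog par false (gg i).
Proof. by elim: i => //= i IH; apply: (homog_br LS ef IH). Qed.

Let hyy i : br h (yy i) = i.+1%:R *: yy i.
Proof.
elim: i => [|i IH] /=; first by rewrite scale1r.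
rewrite (jacE LS _ _ eh ex) // hx IH (brZr LS) -[X in X + _]scale1r -scalerDl.
by rewrite -[i.+2]add1n natrD.
Qed.

Let xf : br x f = - h.
Proof. by rewrite (symE LS _ ex ef) // fx. Qed.
Let xh : br x h = - x.
Proof. by rewrite (symE LS _ ex eh) // hx. Qed.
Let fh : br f h = f.
Proof. by rewrite (symE LS _ ef eh) // hf opprK. Qed.
Let xg : br x g = 0.
Proof. by rewrite (symE LS _ ex eg) // gx oppr0. Qed.

Let hgg i : br h (gg i) = - i.+1%:R *: gg i.
Proof.
elim: i => [|i IH] /=; first by rewrite scaleN1r.
rewrite (jacE LS _ _ eh ef) // hf IH (brZr LS) (brNl LS) -scaleN1r -scalerDl.
by rewrite -opprD -[i.+2]add1n natrD.
Qed.

(** Each further [f] contributes the [h]-weight of the next [gg], so the coefficient is 1 + 2 + ...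
    + (j+1). *)
Let xgg j : br x (gg j.+1) = 'C(j.+2, 2)%:R *: gg j.
Proof.
elim: j => [|j IH].
  by rewrite /= (jacE LS _ _ ex ef) // xg (br0r LS) addr0 xf (brNl LS) hg opprK scale1r.
rewrite -[gg j.+2]/(br f (gg j.+1)) (jacE LS _ _ ex ef) // IH xf (brNl LS) hgg.
rewrite scaleNr opprK (brZr LS) -[br f (gg j)]/(gg j.+1) -scalerDl -natrD.
by rewrite [in RHS]binS bin1 addnC.
Qed.

Let br_gg_y : forall j, br (gg j) y = if j == 0%N then h else if j == 1%N then f else 0.
Proof.
have step j : br (gg j.+1) y = br f (br (gg j) y).
  by rewrite [gg _.+1]/= (jacE LS _ _ ef (egg j)) // fy (br0r LS) addr0.
case=> [|[|j]]; [exact: gy|by rewrite step /= gy|].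
elim: j => [|j IH]; first by rewrite !step /= gy fh ff.
by rewrite step IH /= (br0r LS).
Qed.

(** Induction on [i], moving [x] across the bracket. The coefficients of [h] and [f] are recorded
    with a common sign because the next coefficient of [h] is a positive combination of both: no
    cancellation can occur, and it stays nonzero in characteristic 0. *)
Let br_gg_yy i : exists (b d : nat) (s : bool) (e : F), [/\ (0 < b)%N, (0 < d)%N &
  forall j, br (gg j) (yy i) =
    if j == i then (-1) ^+ s *: (b%:R *: h)
    else if j == i.+1 then (-1) ^+ s *: (d%:R *: f)
    else if j.+1 == i then e *: x else 0].
Proof.
elim: i => [|i [b [d [s [e [b0 d0 IH]]]]]].
  exists 1%N, 1%N, false, 0; split=> // j; rewrite br_gg_y !scale1r.
  by case: j => [|[|j]].
have recur j : br (gg j) (yy i.+1) = br x (br (gg j) (yy i))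
    - (if j is j'.+1 then 'C(j'.+2, 2)%:R *: br (gg j') (yy i) else 0).
  rewrite [yy i.+1]/= (jacE LS _ _ (egg j) ex) // addrC; congr (_ + _).
  rewrite (symE LS _ (egg j) ex) // (brNl LS); congr (- _).
  by case: j => [|j]; [rewrite xg (br0l LS)|rewrite xgg (brZl LS)].
exists ('C(i.+2, 2) * b + d)%N, ('C(i.+3, 2) * d)%N, (~~ s), (- ((-1) ^+ s * b%:R)
   - (if i is i'.+1 then 'C(i'.+2, 2)%:R * e else 0)).
split; rewrite ?addn_gt0 ?d0 ?orbT ?muln_gt0 ?bin_gt0 //.
move=> j; rewrite recur signrN !scaleNr.
have [->|j1] := eqVneq j i.+1.
  rewrite !IH eqxx (gtn_eqF (ltnSn i)) !(brZr LS) xf !scalerN -opprD.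
  by rewrite eqxx !scalerA -scalerDl natrD natrM; congr (- (_ *: _)); ring.
have [->|j2] := eqVneq j i.+2.
  rewrite !IH eqxx (gtn_eqF (ltnSn i.+1)) (gtn_eqF (ltnW _)) //.
  rewrite (gtn_eqF (ltnSn i)) (gtn_eqF (ltnW _ : i < i.+3)%N) // (br0r LS) add0r.
  by rewrite !scalerA natrM; congr (- (_ *: _)); ring.
case: (ltngtP j i) => ji.
- have ->: j.+1 == i.+1 = false by rewrite eqSS ltn_eqF.
  rewrite !IH (ltn_eqF ji) (ltn_eqF (ltnW ji : j < i.+1)%N).
  have -> : br x (if j.+1 == i then e *: x else 0) = 0.
    by case: ifP => _; rewrite ?(brZr LS) ?xx ?scaler0 ?(br0r LS).
  case: j ji {j1 j2} => [|j] ji; first by rewrite subr0.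
  rewrite !IH (ltn_eqF (ltnW ji)) (ltn_eqF (ltnW (ltnW ji) : j < i.+1)%N).
  by rewrite (ltn_eqF ji) scaler0 subr0.
- have {}ji : (i.+2 < j)%N by move: j1 j2 ji; lia.
  rewrite !IH; do !rewrite ifN; try lia.
  case: j ji {j1 j2} => [|j] ji; first by lia.
  rewrite IH; do !rewrite ifN; try lia.
  by rewrite (br0r LS) scaler0 subr0.
- rewrite ji eqxx IH eqxx !(brZr LS) xh.
  case: i {j1 j2 ji recur} IH => [|i] IH.
    by rewrite !subr0 scalerA scalerN scaleNr.
  rewrite IH ifN; last lia.
  rewrite ifN; last lia.
  by rewrite eqxx !scalerA scalerN scalerBl scaleNr.
Qed.

(** Distinct even indices differ by at least 2. This skips the neighbouring cases, where the bracket
    is a multiple of [f] or [x], and makes the pairing of [G] with [Y] diagonal. *)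
Let Y i := yy (i.*2).
Let G i := gg (i.*2).

Let GY i j : i != j -> br (G i) (Y j) = 0.
Proof.
move=> ij; have [b [d [s [e [_ _ ->]]]]] := br_gg_yy (j.*2).
by do !rewrite ifN //; lia.
Qed.

Let GYE i : exists2 a : F, a != 0 & br (G i) (Y i) = a *: h.
Proof.
have [b [d [s [e [b0 _ E]]]]] := br_gg_yy (i.*2).
exists ((-1) ^+ s * b%:R); first by rewrite mulf_neq0 ?signr_eq0 ?natF_neq0.
by rewrite E eqxx scalerA.
Qed.

Let Gz i : br (G i) z = 0.
Proof.
rewrite /G; elim: (i.*2) => [|j IH] //=.
by rewrite -[br (br _ _) _](addrK (br (gg j) (br f z))) -(jacE LS _ _ ef (egg j)) //
  IH fz !(br0r LS) subr0.
Qed.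

Definition free_word (l : seq nat) : L := foldr (fun i => br (iter (i.*2) (br x) y)) z l.
(** The left fold applies first the operator dual to the outermost letter of a word. *)
Let lower (l : seq nat) (v : L) : L := foldl (fun w i => br (G i) w) v l.

Let hword l : exists2 n : nat, (0 < n)%N & br h (free_word l) = n%:R *: free_word l.
Proof.
elim: l => [|i l [n n0 IH]] /=; first by exists 1%N; rewrite ?hz ?scale1r.
exists ((i.*2).+1 + n)%N => //.
by rewrite (jacE LS _ _ eh (eyy _)) // IH hyy (brZr LS) (brZl LS) natrD scalerDl.
Qed.

Let G_notin i l : i \notin l -> br (G i) (free_word l) = 0.
Proof.
elim: l => [|j l IH] /=; first by rewrite Gz.
rewrite inE negb_or => /andP[ij il].
rewrite (jacE LS _ _ (egg _) (eyy _)) // (IH il) (br0r LS) addr0.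
by rewrite (GY ij : br (gg _) (yy _) = 0) (br0l LS).
Qed.

(** [G i] commutes with the letters of [l] and kills [z], so only the leading letter contributes.
    There it produces a multiple of [h], which acts on the rest of the word by a positive
    integer. *)
Let G_in i l : i \notin l ->
  exists2 a : F, a != 0 & br (G i) (free_word (i :: l)) = a *: free_word l.
Proof.
move=> il; have [a a0 E] := GYE i; have [n n0 E2] := hword l.
exists (a * n%:R); first by rewrite mulf_neq0 ?natF_neq0.
rewrite /= (jacE LS _ _ (egg _) (eyy _)) // (G_notin il) (br0r LS) addr0.
rewrite (E : br (gg _) (yy _) = _).
by rewrite (brZl LS) E2 scalerA.
Qed.

Let lower_lin l a v w : lower l (a *: v + w) = a *: lower l v + lower l w.
Proof. by elim: l v w => //= i l IH v w; rewrite (br_linr LS) IH. Qed.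

Let lower0 l : lower l 0 = 0.
Proof. by elim: l => //= i l IH; rewrite (br0r LS). Qed.

Let lowerZ l a v : lower l (a *: v) = a *: lower l v.
Proof. by rewrite -[a *: v]addr0 lower_lin lower0 addr0. Qed.

Let lower_sum l (I : Type) (r : seq I) (c : I -> F) (v : I -> L) :
  lower l (\sum_(i <- r) c i *: v i) = \sum_(i <- r) c i *: lower l (v i).
Proof.
by elim: r => [|i r IH]; rewrite ?big_nil ?lower0 // !big_cons lower_lin IH.
Qed.

Let lower_notin i l s : i \notin l -> lower (i :: s) (free_word l) = 0.
Proof. by move=> il; rewrite /= [br _ _](G_notin il) lower0. Qed.

(* The two alternatives of a block have the same letter sum, so every choice of bits
   yields a word of the same degree. *)
Fixpoint block_word (t : nat) (bits : seq bool) : seq nat :=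
  if bits is c :: r then
    (if c then [:: 4 * t; 4 * t + 3] else [:: 4 * t + 1; 4 * t + 2])%N ++ block_word t.+1 r
  else [::].

Let block_word_ge t bits i : i \in block_word t bits -> (4 * t <= i)%N.
Proof.
elim: bits t => //= c r IH t; rewrite mem_cat => /orP[|/IH]; last lia.
by case: c; rewrite !inE => /orP[] /eqP ->; lia.
Qed.

Let lower_block t r : exists2 a : F, a != 0 &
  lower (block_word t r) (free_word (block_word t r)) = a *: z.
Proof.
elim: r t => [|c r IH] t /=; first by exists 1; rewrite ?oner_eq0 ?scale1r.
have [a a0 E] := IH t.+1.
have stp i j : (i < 4 * t.+1)%N -> (j < 4 * t.+1)%N -> i != j ->
   exists2 b : F, b != 0 & lower ([:: i; j] ++ block_word t.+1 r)
     (free_word ([:: i; j] ++ block_word t.+1 r)) = b *: z.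
  move=> hi hj ij.
  have nj : j \notin block_word t.+1 r by apply/negP => /block_word_ge; lia.
  have ni : i \notin j :: block_word t.+1 r.
    by rewrite inE negb_or ij; apply/negP => /block_word_ge; lia.
  have [a1 a10 E1] := G_in ni; have [a2 a20 E2] := G_in nj.
  exists (a1 * (a2 * a)); first by rewrite !mulf_neq0.
  by rewrite [LHS]/= [br (G i) _]E1 (brZr LS) [br (G j) _]E2 scalerA lowerZ E !scalerA mulrA.
by case: c; apply: stp; lia.
Qed.

(** Equal leading blocks are stripped off up to a scalar. At the first block that differs, the
    leading letter of one word occurs nowhere in the other, so its operator kills that word. *)
Let lower_block_neq t r r' : size r = size r' -> r != r' ->
  lower (block_word t r) (free_word (block_word t r')) = 0.
Proof.
elim: r r' t => [|c r IH] [|c' r'] //= t [sz].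
have nin i r0 : (i < 4 * t.+1)%N -> i \notin block_word t.+1 r0.
  by move=> hi; apply/negP => /block_word_ge; lia.
have [->|cc _] := eqVneq c c'; last first.
  by case: c c' cc => [] [] // _; apply: (@lower_notin _ [:: _, _ & _] [:: _ & _]);
     rewrite !inE !negb_or nin ?andbT; lia.
rewrite eqseq_cons eqxx => /(IH _ t.+1 sz) E.
have stp i j : (i < 4 * t.+1)%N -> (j < 4 * t.+1)%N -> i != j ->
   lower ([:: i; j] ++ block_word t.+1 r) (free_word ([:: i; j] ++ block_word t.+1 r')) = 0.
  move=> hi hj ij.
  have ni : i \notin j :: block_word t.+1 r'.
    by rewrite inE negb_or ij nin.
  have [a1 a10 E1] := G_in ni; have [a2 a20 E2] := G_in (nin j r' hj).
  by rewrite [LHS]/= [br (G i) _]E1 (brZr LS) [br (G j) _]E2 scalerA lowerZ E scaler0.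
by case: c'; apply: stp; lia.
Qed.

(** Lowering along one of the words kills all the others and sends that word to a nonzero multiple
    of [z], which isolates its coefficient. *)
Lemma block_words_free (I : finType) (r : I -> seq bool) (m : nat) (c : I -> F) :
  injective r -> (forall i, size (r i) = m) ->
  \sum_i c i *: free_word (block_word 0 (r i)) = 0 -> forall i, c i = 0.
Proof.
move=> rI rm /(congr1 (lower _)) E i; move: (E (block_word 0 (r i))).
rewrite lower0 lower_sum (bigD1 i) //= big1 => [|j ji]; last first.
  by rewrite lower_block_neq ?scaler0 ?rm // (inj_eq rI) eq_sym.
have [a a0 ->] := lower_block 0 (r i); rewrite addr0 scalerA => /eqP.
by rewrite scaler_eq0 (negPf z_neq0) mulf_eq0 (negPf a0) !orbF => /eqP.
Qed.

End FreeGrowth.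

(** * Singular vectors of positive degree vanish *)

Section SingularVectors.
Variables (F : fieldType) (n m : nat) (A : 'M[F]_n) (p : 'I_n -> bool).
Variables (alpha : 'M[F]_(m, n)) (hv : 'M[F]_(n, m)) (L : lmodType F).
Variables (br : L -> L -> L) (par : L -> L) (iota : 'rV[F]_m -> L) (X Y : 'I_n -> L).
Hypothesis charF0 : [pchar F] =i pred0.
Hypothesis HC : is_contragredient A p alpha hv br par iota X Y.

Lemma contragredient_lie : is_lie_superalgebra br par.
Proof. by case: HC => _ [_ [_ []]]. Qed.
Let LS := contragredient_lie.

Lemma contragredient_hv_alpha : hv *m alpha = A.
Proof. by case: HC => _ [_ []]. Qed.

Lemma iota_lin a u v : iota (a *: u + v) = a *: iota u + iota v.
Proof. by case: HC => _ [_ [_ [_ [[]]]]]. Qed.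

Lemma iota_inj0 u : iota u = 0 -> u = 0.
Proof. by case: HC => _ [_ [_ [_ [[_ h] _]]]]; apply: h. Qed.

Lemma homog_iota u : homog par false (iota u).
Proof. by case: HC => _ [_ [_ [_ [_ [[h _ _] _]]]]]; rewrite /homog scale1r h. Qed.

Lemma homog_X i : homog par (p i) (X i).
Proof. by case: HC => _ [_ [_ [_ [_ [[_ h _] _]]]]]; apply: h. Qed.

Lemma homog_Y i : homog par (p i) (Y i).
Proof. by case: HC => _ [_ [_ [_ [_ [[_ _ h] _]]]]]; apply: h. Qed.

Lemma br_iota_iota u v : br (iota u) (iota v) = 0.
Proof. by case: HC => _ [_ [_ [_ [_ [_ [[h _ _ _] _]]]]]]; apply: h. Qed.

Lemma br_iota_X u i : br (iota u) (X i) = (u *m alpha) 0 i *: X i.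
Proof. by case: HC => _ [_ [_ [_ [_ [_ [[_ h _ _] _]]]]]]; apply: h. Qed.

Lemma br_iota_Y u i : br (iota u) (Y i) = - ((u *m alpha) 0 i) *: Y i.
Proof. by case: HC => _ [_ [_ [_ [_ [_ [[_ _ h _] _]]]]]]; apply: h. Qed.

Lemma br_X_Y i j : br (X i) (Y j) = if i == j then iota (row i hv) else 0.
Proof. by case: HC => _ [_ [_ [_ [_ [_ [[_ _ _ h] _]]]]]]; apply: h. Qed.

Lemma contragredient_gen (S : L -> Prop) :
  (forall x y, S x -> S y -> S (x + y)) -> (forall a x, S x -> S (a *: x)) ->
  (forall x y, S x -> S y -> S (br x y)) ->
  (forall u, S (iota u)) -> (forall i, S (X i)) -> (forall i, S (Y i)) ->
  forall x, S x.
Proof. by case: HC => _ [_ [_ [_ [_ [_ [_ [h _]]]]]]]; apply: h. Qed.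

Lemma contragredient_ideal (I : L -> Prop) :
  I 0 -> (forall x y, I x -> I y -> I (x + y)) -> (forall a x, I x -> I (a *: x)) ->
  (forall x y, I y -> I (br x y) /\ I (br y x)) ->
  (forall u, I (iota u) -> iota u = 0) -> forall x, I x -> x = 0.
Proof. by case: HC => _ [_ [_ [_ [_ [_ [_ [_ h]]]]]]]; apply: h. Qed.

(** The simple roots are linearly independent, so they can be prescribed the common value 1; the
    adjoint action of the resulting Cartan element is the principal grading. *)
Lemma principal_coweight : exists r, r *m alpha = const_mx 1 :> 'rV_n.
Proof.
have full : row_full alpha by rewrite -col_leq_rank; case: HC => _ [-> _].
by have /submxP[r ->] := submx_full (const_mx 1 : 'rV_n) full; exists r.
Qed.

(* For a highest-weight-like vector [a] (killed by all [Y j]) this already is the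
   two-sided ideal generated by [a]. *)
Inductive raised (a : L) : L -> Prop :=
| raised_base : raised a a
| raised0 : raised a 0
| raisedD v w : raised a v -> raised a w -> raised a (v + w)
| raisedZ c v : raised a v -> raised a (c *: v)
| raised_X i v : raised a v -> raised a (br (X i) v).

Section Singular.
Variables (a : L) (b : bool) (la : 'rV[F]_m -> F).
Hypotheses (ha : homog par b a) (Ha : forall u, br (iota u) a = la u *: a).
Hypothesis deg_a : forall r, r *m alpha = const_mx 1 -> exists d, la r = d.+1%:R.
Hypothesis Ya : forall j, br (Y j) a = 0.

Let raised_par v : raised a v -> raised a (par v).
Proof.
elim=> [| |v1 v2 _ I1 _ I2|c v1 _ I1|i v1 _ I1].
- by rewrite ha; apply/raisedZ/raised_base.
- by rewrite (par0 LS); apply: raised0.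
- by rewrite (parD LS); apply: raisedD.
- by rewrite (parZ LS); apply: raisedZ.
- by rewrite (par_br LS) homog_X (brZl LS); apply/raisedZ/raised_X.
Qed.

Let raised_iota u v : raised a v -> raised a (br (iota u) v).
Proof.
elim=> [| |v1 v2 _ I1 _ I2|c v1 _ I1|i v1 R1 I1].
- by rewrite Ha; apply/raisedZ/raised_base.
- by rewrite (br0r LS); apply: raised0.
- by rewrite (brDr LS); apply: raisedD.
- by rewrite (brZr LS); apply: raisedZ.
- rewrite (jacE LS _ _ (homog_iota u) (homog_X i)) // br_iota_X (brZl LS).
  by apply: raisedD; [apply/raisedZ/raised_X|apply: raised_X].
Qed.

Let raised_Y j v : raised a v -> raised a (br (Y j) v).
Proof.
elim=> [| |v1 v2 _ I1 _ I2|c v1 _ I1|i v1 R1 I1].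
- by rewrite Ya; apply: raised0.
- by rewrite (br0r LS); apply: raised0.
- by rewrite (brDr LS); apply: raisedD.
- by rewrite (brZr LS); apply: raisedZ.
- rewrite (br_jac LS _ (homog_Y j) (homog_X i)); apply: raisedD; last exact/raisedZ/raised_X.
  rewrite (br_sym LS (homog_Y j) (homog_X i)) br_X_Y -scaleN1r !(brZl LS).
  do 2 apply: raisedZ.
  by case: eqP => _; rewrite ?(br0l LS); [apply: raised_iota|apply: raised0].
Qed.

Let two_neq0 : 2%:R != 0 :> F.
Proof. by rewrite ((pcharf0P F).1 charF0). Qed.

(** Projection onto the component of parity [b0]. *)
Let half s (b0 : bool) := 2%:R^-1 *: (s + (-1) ^+ b0 *: par s).

Let halfE s : s = half s false + half s true.
Proof.
rewrite /half -scalerDr scale1r scaleN1r addrACA subrr addr0 -mulr2n -scaler_nat.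
by rewrite scalerA mulVf ?scale1r.
Qed.

Let half_homog s b0 : homog par b0 (half s b0).
Proof.
rewrite /homog /half (parZ LS) (parD LS) (parZ LS) (parK LS) !scalerA mulrC -scalerA.
by congr (_ *: _); rewrite scalerDr scalerA -signr_addb addbb scale1r addrC.
Qed.

Let raised_half v b0 : raised a v -> raised a (half v b0).
Proof. by move=> R; apply/raisedZ/raisedD => //; apply/raisedZ/raised_par. Qed.

Let raised_brl s v : raised a v -> raised a (br s v).
Proof.
(* The Jacobi identity is available for homogeneous elements only, so the induction over the
   generators carries the claim for both parity components of [s]. *)
pose S s := forall b0 v, raised a v -> raised a (br (half s b0) v).
suff: S s.
  move=> Ss Rv; rewrite (halfE s) (brDl LS).
  by apply: raisedD; apply: Ss.
have S_homog c s1 : homog par c s1 -> (forall v, raised a v -> raised a (br s1 v)) -> S s1.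
  move=> hs I b0 v0 R; rewrite /half (brZl LS) (brDl LS) hs !(brZl LS).
  by apply/raisedZ/raisedD; [|do 2 apply: raisedZ]; apply: I.
elim/contragredient_gen: s {v} => [s1 s2 S1 S2|c s1 S1|s1 s2 S1 S2|u|i|i] .
- move=> b0 v R; have -> : half (s1 + s2) b0 = half s1 b0 + half s2 b0.
    by rewrite /half (parD LS) [_ *: (par s1 + _)]scalerDr addrACA scalerDr.
  by rewrite (brDl LS); apply: raisedD; [apply: S1|apply: S2].
- move=> b0 v R; have -> : half (c *: s1) b0 = c *: half s1 b0.
    by rewrite /half (parZ LS) (scalerA _ c) mulrC -scalerA -scalerDr !scalerA mulrC.
  by rewrite (brZl LS); apply/raisedZ/S1.
- have I v : raised a v -> raised a (br (br s1 s2) v).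
    have J b1 b2 w : raised a w -> raised a (br (br (half s1 b1) (half s2 b2)) w).
      move=> R; have -> : br (br (half s1 b1) (half s2 b2)) w = br (half s1 b1)
          (br (half s2 b2) w) - (-1) ^+ (b1 && b2) *: br (half s2 b2) (br (half s1 b1) w).
        by rewrite (br_jac LS w (half_homog s1 b1) (half_homog s2 b2)) addrK.
      apply: raisedD; first by apply/S1/S2.
      by rewrite -scaleNr; apply/raisedZ/S2/S1.
    move=> R; rewrite (halfE s1) (halfE s2) !(brDl LS, brDr LS).
    by do ! [apply: J R| apply: raisedD].
  move=> b0 v R; rewrite /half (brZl LS) (brDl LS) (brZl LS).
  apply/raisedZ/raisedD; first exact: I.
  (* [par] is an involution, so bracketing with the image of [br s1 s2] under [par] is bracketing
     with [br s1 s2] conjugated by [par]. *)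
  apply: raisedZ; rewrite -[v](parK LS) -(par_br LS); apply/raised_par/I/raised_par/R.
- by apply: (S_homog _ _ (homog_iota u)) => v; apply: raised_iota.
- by apply: (S_homog _ _ (homog_X i)) => v; apply: raised_X.
- by apply: (S_homog _ _ (homog_Y i)) => v; apply: raised_Y.
Qed.

Let raised_brr s v : raised a v -> raised a (br v s).
Proof.
move=> R; rewrite (halfE s) (halfE v) !(brDl LS, brDr LS).
have J b1 b2 : raised a (br (half v b1) (half s b2)).
  rewrite (br_sym LS (half_homog _ _) (half_homog _ _)) -scaleN1r.
  by do 2 apply: raisedZ; apply/raised_brl/raised_half.
by do ! [apply: J| apply: raisedD].
Qed.

(* Raised vectors lie in positive degree: they are annihilated by some
   [\prod_(1 <= k <= N) (ad r - k)], whereas the Cartan subalgebra has degree [0]. *)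
Let adprod r := fix R N v := if N is N'.+1 then br (iota r) (R N' v) - N%:R *: R N' v else v.

Let adprod_lin r N c v w : adprod r N (c *: v + w) = c *: adprod r N v + adprod r N w.
Proof.
elim: N => //= N ->; rewrite (br_linr LS) scalerDr opprD addrACA scalerBr.
by rewrite !scalerA mulrC.
Qed.

Let adprod0 r N : adprod r N 0 = 0.
Proof. by elim: N => //= N ->; rewrite (br0r LS) scaler0 subr0. Qed.

Let adprod_mono r N M v : (N <= M)%N -> adprod r N v = 0 -> adprod r M v = 0.
Proof.
move=> /subnK <- E; elim: (M - N)%N => //= k ->.
by rewrite (br0r LS) scaler0 subr0.
Qed.

(** The raised vectors form an ideal. As [a] has positive principal degree, this ideal meets the
    Cartan subalgebra trivially, and a contragredient superalgebra has no nonzero ideal of that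
    kind. *)
Lemma singular_vector0 : a = 0.
Proof.
have [r hr] := principal_coweight; have [d hd] := deg_a hr.
have natF0 N : N.+1%:R != 0 :> F by rewrite ((pcharf0P F).1 charF0).
have rX i : br (iota r) (X i) = X i by rewrite br_iota_X hr mxE scale1r.
have ann v : raised a v -> exists N, adprod r N v = 0.
  elim=> [| |v1 v2 _ [N1 I1] _ [N2 I2]|c v1 _ [N1 I1]|i v1 R1 [N1 I1]].
  - have E N : exists c, adprod r N a = c *: a.
      elim: N => [|N [c E]] /=; first by exists 1; rewrite scale1r.
      exists (c * la r - N.+1%:R * c).
      by rewrite E (brZr LS) Ha scalerBl !scalerA.
    exists d.+1 => /=; have [c ->] := E d.
    by rewrite (brZr LS) Ha hd !scalerA mulrC subrr.
  - by exists 0%N.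
  - exists (maxn N1 N2); rewrite -[v1]scale1r adprod_lin.
    rewrite (adprod_mono (leq_maxl _ _) I1) (adprod_mono (leq_maxr _ _) I2).
    by rewrite scaler0 addr0.
  - by exists N1; rewrite -[_ *: _]addr0 adprod_lin I1 adprod0 scaler0 addr0.
  - exists N1.+1.
    (* [X i] has degree 1, so pulling it out turns each factor [ad r - k] into [ad r - (k - 1)]; the
       factor for k = 1 becomes the bare [br (iota r)]. *)
    have E N : adprod r N.+1 (br (X i) v1) = br (X i) (br (iota r) (adprod r N v1)).
      elim: N => [|N IH].
        by rewrite /= (jacE LS _ _ (homog_iota r) (homog_X i)) // rX scale1r addrC addKr.
      rewrite -[LHS]/(br (iota r) (adprod r N.+1 (br (X i) v1))
               - N.+2%:R *: adprod r N.+1 (br (X i) v1)).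
      rewrite IH (jacE LS _ _ (homog_iota r) (homog_X i)) // rX /=.
      rewrite !(brBr LS) !(brZr LS) -[N.+2]add1n natrD scalerDl scale1r opprD.
      by rewrite addrACA subrr add0r.
    by rewrite E I1 !(br0r LS).
apply: (@contragredient_ideal (raised a)); last exact: raised_base.
- exact: raised0.
- by move=> x y; apply: raisedD.
- by move=> c x; apply: raisedZ.
- by move=> x y R; split; [apply: raised_brl|apply: raised_brr].
move=> u /ann[N E].
(* On the Cartan subalgebra [ad r] is zero, so the product acts as multiplication by (-1)^N N!. *)
elim: N E => // N IH /= E; apply: IH; move: E.
have -> : br (iota r) (adprod r N (iota u)) = 0.
  elim: N => [|N IH] /=; first exact: br_iota_iota.
  by rewrite (brBr LS) (brZr LS) IH (br0r LS) scaler0 subr0.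
by move/eqP; rewrite sub0r oppr_eq0 scaler_eq0 (negPf (natF0 _)) => /eqP.
Qed.

End Singular.
End SingularVectors.

(** * Pairing of the vectors built from an odd Heisenberg superalgebra *)

Section OddHeisenberg.
Variables (F : fieldType) (L : lmodType F) (br : L -> L -> L) (par : L -> L).
Hypothesis LS : is_lie_superalgebra br par.
Hypothesis two_neq0 : 2%:R != 0 :> F.
Variables (u v : nat -> L) (c : nat -> F) (e f k t : L).
Hypotheses (ou : forall i, homog par true (u i)) (ov : forall i, homog par true (v i))
  (ee : homog par false e) (ef : homog par false f)
  (ek : homog par false k) (et : homog par false t).
Hypothesis vu : forall i j, (i < 3)%N -> (j < 3)%N ->
  br (v j) (u i) = if j == i then c i *: k else 0.
Hypothesis uu : forall i j, (i < 3)%N -> (j < 3)%N -> i != j -> br (u i) (u j) = 0.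
Hypotheses (fu : forall i, br f (u i) = 0) (ve : forall i, br (v i) e = 0)
  (ku : forall i, br k (u i) = 0) (kv : forall i, br k (v i) = 0)
  (tu : forall i, br t (u i) = - u i) (tv : forall i, br t (v i) = v i)
  (ke : br k e = e) (kf : br k f = - f) (te : br t e = 2%:R *: e)
  (tf : br t f = - (2%:R *: f)) (fe : br f e = - t).

(** In the application [e], [f], [t] are X_3, Y_3, h_3 and [k] is a multiple of h_1, so these are
    the vectors w_ij and their lowering counterparts. *)
Definition spinor i j := br (u i) (br (u j) e).
Definition cospinor i j := br (v i) (br (v j) f).

Let oue i : homog par true (br (u i) e).
Proof. exact: (homog_br LS (ou i) ee). Qed.
Let ovf i : homog par true (br (v i) f).
Proof. exact: (homog_br LS (ov i) ef). Qed.

Lemma homog_spinor i j : homog par false (spinor i j).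
Proof. exact: (homog_br LS (ou i) (oue j)). Qed.

Lemma homog_cospinor i j : homog par false (cospinor i j).
Proof. exact: (homog_br LS (ov i) (ovf j)). Qed.

Let k_ue j : br k (br (u j) e) = br (u j) e.
Proof. by rewrite (jacE LS _ _ ek (ou _)) // ku (br0l LS) add0r ke. Qed.

Let k_spinor i j : br k (spinor i j) = spinor i j.
Proof. by rewrite (jacE LS _ _ ek (ou _)) // ku (br0l LS) add0r k_ue. Qed.

Let t_ue j : br t (br (u j) e) = br (u j) e.
Proof.
rewrite (jacE LS _ _ et (ou _)) // tu te (brZr LS) (brNl LS).
by rewrite scaler_nat mulr2n addKr.
Qed.

Let t_spinor i j : br t (spinor i j) = 0.
Proof.
rewrite (jacE LS _ _ et (ou _)) // tu t_ue (brNl LS); exact: addNr.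
Qed.

Let k_cospinor i j : br k (cospinor i j) = - cospinor i j.
Proof.
rewrite (jacE LS _ _ ek (ov _)) // kv (br0l LS) add0r.
by rewrite (jacE LS _ _ ek (ov _)) // kv (br0l LS) add0r kf !(brNr LS).
Qed.

Let t_cospinor i j : br t (cospinor i j) = 0.
Proof.
rewrite (jacE LS _ _ et (ov _)) // tv (jacE LS _ _ et (ov _)) // tv tf.
rewrite (brNr LS) (brZr LS) scaler_nat mulr2n opprD addrA subrr add0r (brNr LS).
exact: subrr.
Qed.

(** The [k]-weight 1 comes from [e] alone, while the [t]-weights -1, -1 and 2 of the three factors
    cancel. *)
Lemma weight_spinor i j : br (k - 2%:R^-1 *: t) (spinor i j) = spinor i j.
Proof. by rewrite (brBl LS) (brZl LS) k_spinor t_spinor scaler0 subr0. Qed.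

Lemma weight_cospinor i j : br (k - 2%:R^-1 *: t) (cospinor i j) = - cospinor i j.
Proof. by rewrite (brBl LS) (brZl LS) k_cospinor t_cospinor scaler0 subr0. Qed.

Let f_ue i : br f (br (u i) e) = - u i.
Proof.
rewrite (jacE LS _ _ ef (ou _)) // fu (br0l LS) add0r fe (brNr LS).
by rewrite (symE LS _ (ou i) et) // tu opprK.
Qed.

Let f_spinor i j : (i < 3)%N -> (j < 3)%N -> i != j -> br f (spinor i j) = 0.
Proof.
move=> hi hj ij; rewrite (jacE LS _ _ ef (ou _)) // fu (br0l LS) add0r f_ue.
by rewrite (brNr LS) uu ?oppr0.
Qed.

Let v_ue l i : (i < 3)%N -> (l < 3)%N ->
  br (v l) (br (u i) e) = if l == i then c i *: e else 0.
Proof.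
move=> hi hl; rewrite (jacO LS _ (ov _) (ou _)) ve (br0r LS) subr0 vu //.
by case: eqP => _; rewrite ?(br0l LS) // (brZl LS) ke.
Qed.

Let v_spinor l i j : (i < 3)%N -> (j < 3)%N -> (l < 3)%N ->
  br (v l) (spinor i j) = (if l == i then c i *: br (u j) e else 0)
                         - (if l == j then c j *: br (u i) e else 0).
Proof.
move=> hi hj hl; rewrite (jacO LS _ (ov _) (ou _)) vu // v_ue //; congr (_ - _).
  by case: eqP => _; rewrite ?(br0l LS) // (brZl LS) k_ue.
by case: eqP => _; rewrite ?(br0r LS) // (brZr LS).
Qed.

Let vf_spinor l i j : (i < 3)%N -> (j < 3)%N -> (l < 3)%N -> i != j ->
  br (br (v l) f) (spinor i j) = (if l == i then c i *: u j else 0)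
                                - (if l == j then c j *: u i else 0).
Proof.
move=> hi hj hl ij.
have := jacE LS (spinor i j) (andbF _) (ov l) ef.
rewrite f_spinor // (br0r LS) => /eqP; rewrite eq_sym addr_eq0 => /eqP ->.
rewrite v_spinor // (brBr LS) opprB.
(* [i + j - n] is the other member of the pair when [n] is [i] or [j], so one statement serves both
   terms. *)
have E n b : br f (if b then c n *: br (u (i + j - n)) e else 0) =
   - (if b then c n *: u (i + j - n)%N else 0).
  by case: b; rewrite ?(br0r LS) ?oppr0 // (brZr LS) f_ue scalerN.
have := E i (l == i); rewrite addKn => ->; have := E j (l == j); rewrite addnK => ->.
by rewrite opprK addrC.
Qed.

Let vf_ue l i : (i < 3)%N -> (l < 3)%N ->
  br (br (v l) f) (br (u i) e) = if l == i then c i *: (t - k) else 0.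
Proof.
move=> hi hl.
have := jacE LS (br (u i) e) (andbF _) (ov l) ef.
rewrite f_ue (brNr LS) vu // v_ue // => E.
have {E} -> : br (br (v l) f) (br (u i) e) =
   - (if l == i then c i *: k else 0) - br f (if l == i then c i *: e else 0).
  by rewrite E addrK.
case: eqP => _; rewrite ?(br0r LS) ?oppr0 ?addr0 // (brZr LS) fe.
by rewrite scalerN opprK addrC -scalerBr.
Qed.

(** Moving [v l] inside gives two terms. On matching pairs they are [c i * c j] times [- k] and
    times [t - k], with sum proportional to [t - 2 k]. *)
Lemma cospinor_spinor l m i j : (i < 3)%N -> (j < 3)%N -> (l < 3)%N -> (m < 3)%N ->
  (i < j)%N -> (l < m)%N ->
  br (cospinor l m) (spinor i j) =
    if (l == i) && (m == j) then (- (2%:R * c i * c j)) *: (k - 2%:R^-1 *: t) else 0.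
Proof.
move=> hi hj hl hm ij lm.
rewrite /cospinor; set gm := br (v m) f.
have -> : br (br (v l) gm) (spinor i j) =
    br (v l) (br gm (spinor i j)) + br gm (br (v l) (spinor i j)).
  by rewrite (jacO LS _ (ov l) (ovf m)) subrK.
have nij : i != j by rewrite ltn_eqF.
rewrite vf_spinor // v_spinor // !(brBr LS).
have vif b n n' : (n < 3)%N -> br (v l) (if b then c n' *: u n else 0) =
    if b && (l == n) then (c n' * c n) *: k else 0.
  by case: b => hn; rewrite ?(br0r LS) // (brZr LS) vu //; case: eqP; rewrite ?scaler0 ?scalerA.
have gif b n n' : (n < 3)%N -> br gm (if b then c n' *: br (u n) e else 0) =
    if b && (m == n) then (c n' * c n) *: (t - k) else 0.
  case: b => hn; rewrite ?(br0r LS) // (brZr LS) vf_ue //.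
  by case: eqP => _; rewrite ?scaler0 ?scalerA.
rewrite !vif // !gif //.
(* The orderings [i < j] and [l < m] exclude the crossed pairing, in this line and the next. *)
have -> : (m == i) && (l == j) = false by apply/negP => /andP[/eqP ? /eqP ?]; lia.
have -> : (l == j) && (m == i) = false by apply/negP => /andP[/eqP ? /eqP ?]; lia.
rewrite sub0r subr0 andbC; case: ifP => _; last by rewrite oppr0 addr0.
rewrite -scaleNr scalerBr !scaleNr scalerBr scalerA.
rewrite opprB addrCA -opprD -scalerDl; congr (_ *: _ - _ *: _); last by ring.
by field.
Qed.

End OddHeisenberg.

(** * Polynomial bounds against the degrees of words *)

Lemma poly_lt_exp2 (C d : nat) : exists m, (C * (6 + 32 * m ^ 2 + 2 * m + 1) ^ d < 2 ^ m)%N.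
Proof.
have ha n : (n < 2 ^ n)%N by apply: ltn_expl.
(* With m = 2^s the left side is below 2^(C + (2s + 6) d). For s = 3a that exponent is quadratic in
   [a], whereas 2^s = (2^a)^3 is at least a^3; the constants in [a] make the comparison hold. *)
have [a aE] : exists a, a = (9 * d + C + 9)%N by eexists.
have [s sE] : exists s, s = (3 * a)%N by eexists.
exists (2 ^ s)%N.
have le1 : (6 + 32 * (2 ^ s) ^ 2 + 2 * 2 ^ s + 1 <= 2 ^ (2 * s + 6))%N.
  have -> : (2 ^ (2 * s + 6) = (2 ^ s) ^ 2 * 2 ^ 6)%N by rewrite expnD -expnM (mulnC s).
  have : (27 <= 2 ^ s)%N by apply: leq_trans (ltnW (ha s)); lia.
  move: (2 ^ s)%N => q q27; rewrite -mulnn (_ : 2 ^ 6 = 64)%N //.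
  have := leq_mul q27 (leqnn q); lia.
apply: (@leq_ltn_trans (2 ^ (C + (2 * s + 6) * d))).
  rewrite expnD expnM; apply: leq_mul; first exact: ltnW.
  move: (6 + _ + _ + 1)%N (2 ^ (2 * s + 6))%N le1 => P Q le1.
  by elim: (d) => [|n IH]; rewrite ?expn0 // !expnS leq_mul.
rewrite ltn_exp2l //; apply: (@leq_trans (a * a * a)%N); last first.
  have -> : (2 ^ s = 2 ^ a * 2 ^ a * 2 ^ a)%N by rewrite -!expnD sE; congr (2 ^ _)%N; lia.
  by apply: leq_mul; [apply: leq_mul|]; apply/ltnW/ha.
have h1 : (9 * d * a <= a * a)%N by rewrite leq_mul //; lia.
have h2 : (9 * a <= a * a)%N by rewrite leq_mul //; lia.
have h3 : (9 * (a * a) <= a * a * a)%N by rewrite -mulnA leq_mul //; lia.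
have -> : ((2 * s + 6) * d = 6 * (d * a) + 6 * d)%N by rewrite sE; lia.
move: h1 h2 h3; rewrite -(mulnA 9) -(mulnA a); move: (a * a)%N (d * a)%N (a * _)%N => *; lia.
Qed.

Lemma princ_deg_eq (F : fieldType) (L : lmodType F) n m (br : L -> L -> L)
  (iota : 'rV[F]_m -> L) (X Y : 'I_n -> L) (a b : int) x :
  a = b -> princ_deg br iota X Y a x -> princ_deg br iota X Y b x.
Proof. by move=> ->. Qed.

Section PrincipalDegrees.
Variables (F : fieldType) (L : lmodType F) (n m : nat) (br : L -> L -> L).
Variables (iota : 'rV[F]_m -> L) (X Y : 'I_n -> L).
Let pd := princ_deg br iota X Y.

Lemma princ_deg_spinor u (e : L) i j : (forall l : nat, pd l.+1 (u l)) -> pd 1 e ->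
  pd (i + j + 3)%N (spinor br u e i j).
Proof. by move=> pu pe; apply: princ_deg_eq (pd_br (pu i) (pd_br (pu j) pe)); lia. Qed.

(** A letter of index i has degree 8 i + 5 and block number t has letter sum 8 t + 3, so that block
    adds 64 t + 34; [z] adds 6. *)
Lemma princ_deg_block_word x y z t r : pd 4 x -> pd 5 y -> pd 6 z ->
  pd (6 + 32 * (size r) ^ 2 + 2 * size r + 64 * t * size r)%N
    (free_word br x y z (block_word t r)).
Proof.
move=> px py pz.
have pi l : pd (4 * l + 5)%N (iter l (br x) y).
  by elim: l => //= l IH; apply: princ_deg_eq (pd_br px IH); lia.
elim: r t => [|a r IH] t; first by rewrite /= !muln0.
have E : (6 + 32 * (size r).+1 ^ 2 + 2 * (size r).+1 + 64 * t * (size r).+1 =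
  8 * (8 * t + 3) + 10 + (6 + 32 * size r ^ 2 + 2 * size r + 64 * t.+1 * size r))%N.
  by ring.
by case: a; apply: princ_deg_eq (pd_br (pi _) (pd_br (pi _) (IH t.+1)));
  rewrite [size _]/= E; lia.
Qed.

End PrincipalDegrees.

(** * Exponential growth for the remaining family *)

Section InfiniteGrowth.
Variables (F : fieldType) (m : nat) (A : 'M[F]_3) (p : 'I_3 -> bool).
Variables (alpha : 'M[F]_(m, 3)) (hv : 'M[F]_(3, m)) (L : lmodType F).
Variables (br : L -> L -> L) (par : L -> L) (iota : 'rV[F]_m -> L) (X Y : 'I_3 -> L).
Hypothesis charF0 : [pchar F] =i pred0.
Hypothesis HC : is_contragredient A p alpha hv br par iota X Y.
Variables (i1 i2 i3 : 'I_3) (b : F).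
Hypotheses (n12 : i1 != i2) (n13 : i1 != i3) (n23 : i2 != i3).
Hypotheses (p1 : p i1 = true) (p2 : p i2 = false) (p3 : p i3 = false).
Hypotheses (A11 : A i1 i1 = 0) (A12 : A i1 i2 = 0) (A13 : A i1 i3 != 0)
  (A21 : A i2 i1 = b) (A22 : A i2 i2 = 2%:R)
  (A31 : A i3 i1 = -1) (A32 : A i3 i2 = 0) (A33 : A i3 i3 = 2%:R).
Hypotheses (b0 : b != 0) (b1 : b + 1 != 0).

Let LS := contragredient_lie HC.
Let h i := iota (row i hv).
(** The scaling makes [k] act on [X i3] as the identity; [v] carries the same factor so that [u] and
    [v] pair to [k]. *)
Let k := iota ((A i1 i3)^-1 *: row i1 hv).
Let u n := iter n (br (X i2)) (X i1).
Let v n := iter n (br (Y i2)) ((A i1 i3)^-1 *: Y i1).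
(** Since [b] is the entry a_21 itself, [c 1] and [c 2] are nonzero exactly when this entry is
    neither 0 nor -1; the value -1 is that of D(2,1,0). *)
Let c n := \prod_(l < n) (l.+1%:R * (b + l%:R)) : F.

Let n21 : i2 != i1. Proof. by rewrite eq_sym. Qed.
Let n31 : i3 != i1. Proof. by rewrite eq_sym. Qed.
Let n32 : i3 != i2. Proof. by rewrite eq_sym. Qed.

Let cases j : [\/ j = i1, j = i2 | j = i3].
Proof.
move: n12 n13 n23; case: i1 => [[|[|[|//]]] ?]; case: i2 => [[|[|[|//]]] ?] //;
case: i3 => [[|[|[|//]]] ?] //; case: j => [[|[|[|//]]] ?] // _ _ _;
by [apply: Or31; apply: val_inj|apply: Or32; apply: val_inj|apply: Or33; apply: val_inj].
Qed.

Let two0 : 2%:R != 0 :> F.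
Proof. by rewrite ((pcharf0P F).1 charF0). Qed.

Let X1 : homog par true (X i1). Proof. by have := homog_X HC i1; rewrite p1. Qed.
Let X2 : homog par false (X i2). Proof. by have := homog_X HC i2; rewrite p2. Qed.
Let X3 : homog par false (X i3). Proof. by have := homog_X HC i3; rewrite p3. Qed.
Let Y1 : homog par true (Y i1). Proof. by have := homog_Y HC i1; rewrite p1. Qed.
Let Y2 : homog par false (Y i2). Proof. by have := homog_Y HC i2; rewrite p2. Qed.
Let Y3 : homog par false (Y i3). Proof. by have := homog_Y HC i3; rewrite p3. Qed.
Let hi w := homog_iota HC w.

Let iotaZ a w : iota (a *: w) = a *: iota w.
Proof.
have i0 : iota 0 = 0.
  by have := iota_lin HC (-1) 0 0; rewrite scaler0 addr0 scaleN1r addNr.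
by rewrite -[a *: w]addr0 (iota_lin HC) i0 addr0.
Qed.

Let kE : k = (A i1 i3)^-1 *: h i1.
Proof. exact: iotaZ. Qed.

Let rowE i j : (row i hv *m alpha) 0 j = A i j.
Proof. by rewrite -row_mul (contragredient_hv_alpha HC) mxE. Qed.

Let rowZE a i j : (a *: row i hv *m alpha) 0 j = a * A i j.
Proof. by rewrite -scalemxAl mxE rowE. Qed.

Let hX i j : br (h i) (X j) = A i j *: X j.
Proof. by rewrite (br_iota_X HC) rowE. Qed.

Let hY i j : br (h i) (Y j) = - A i j *: Y j.
Proof. by rewrite (br_iota_Y HC) rowE. Qed.

Let YX i j : i != j -> br (Y i) (X j) = 0.
Proof.
move=> ij; rewrite (br_sym LS (homog_Y HC i) (homog_X HC j)) (br_X_Y HC).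
by rewrite eq_sym (negPf ij) scaler0 oppr0.
Qed.

Let XY i j : i != j -> br (X i) (Y j) = 0.
Proof. by move=> ij; rewrite (br_X_Y HC) (negPf ij). Qed.

Let Y1X1 : br (Y i1) (X i1) = h i1.
Proof. by rewrite (symO LS Y1 X1) (br_X_Y HC) eqxx. Qed.

Let Y2X2 : br (Y i2) (X i2) = - h i2.
Proof. by rewrite (symE LS _ Y2 X2) // (br_X_Y HC) eqxx. Qed.

Let ou n : homog par true (u n).
Proof. by elim: n => //= n IH; apply: (homog_br LS X2 IH). Qed.

Let ov n : homog par true (v n).
Proof. by elim: n => [|n IH] /=; [apply: (homogZ LS)|apply: (homog_br LS Y2 IH)]. Qed.

Let uS n : u n.+1 = br (X i2) (u n). Proof. by []. Qed.
Let vS n : v n.+1 = br (Y i2) (v n). Proof. by []. Qed.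

Let iota_u w n : br (iota w) (u n) =
  ((w *m alpha) 0 i1 + n%:R * (w *m alpha) 0 i2) *: u n.
Proof.
elim: n => [|n IH]; first by rewrite mul0r addr0 (br_iota_X HC).
rewrite uS (jacE LS _ _ (hi w) X2) // IH (br_iota_X HC) (brZl LS) (brZr LS).
by rewrite -scalerDl; congr (_ *: _); rewrite -[n.+1]addn1 natrD; ring.
Qed.

Let iota_v w n : br (iota w) (v n) =
  - ((w *m alpha) 0 i1 + n%:R * (w *m alpha) 0 i2) *: v n.
Proof.
elim: n => [|n IH].
  by rewrite mul0r addr0 (brZr LS) (br_iota_Y HC) !scalerA mulrC.
rewrite vS (jacE LS _ _ (hi w) Y2) // IH (br_iota_Y HC) (brZl LS) (brZr LS).
by rewrite -scalerDl; congr (_ *: _); rewrite -[n.+1]addn1 natrD; ring.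
Qed.

Let X2k : br (X i2) k = 0.
Proof.
by rewrite kE (brZr LS) (symE LS _ X2 (hi _)) // hX A12 scale0r oppr0 scaler0.
Qed.

Let Y2k : br (Y i2) k = 0.
Proof.
by rewrite kE (brZr LS) (symE LS _ Y2 (hi _)) // hY A12 oppr0 scale0r oppr0 scaler0.
Qed.

(** An sl_2 string computation: the weights b, b + 2, ..., b + 2n of h_2 add up to (n+1)(b+n). *)
Let X2v n : br (X i2) (v n.+1) = - (n.+1%:R * (b + n%:R)) *: v n.
Proof.
have step l : br (X i2) (v l.+1) = - (b + l%:R * 2%:R) *: v l + br (Y i2) (br (X i2) (v l)).
  rewrite vS (jacE LS _ _ X2 Y2) // (br_X_Y HC) eqxx; congr (_ + _).
  by rewrite iota_v !rowE A21 A22.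
elim: n => [|n IH].
  by rewrite step (brZr LS) XY // scaler0 (br0r LS) addr0 mul0r mul1r.
rewrite step IH (brZr LS) -vS -scalerDl; congr (_ *: _).
by rewrite -[n.+2]addn1 -[n.+1]addn1 !natrD; ring.
Qed.

(** Induction on [i]: [br (v j) (X i2)] is a multiple of the preceding [v], and the other Jacobi
    term vanishes because a_12 = 0 makes [X i2] commute with [k]. *)
Let vu i j : br (v j) (u i) = if j == i then c i *: k else 0.
Proof.
have vX1 l : br (v l.+1) (X i1) = 0.
  have step n : br (v n.+1) (X i1) = br (Y i2) (br (v n) (X i1)).
    have := jacE LS (X i1) (erefl : false && true = false) Y2 (ov n).
    by rewrite (YX n21) (br0r LS) addr0 => <-.
  elim: l => [|l IH]; first by rewrite step (brZl LS) Y1X1 -kE Y2k.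
  by rewrite step IH (br0r LS).
elim: i j => [|i IH] [|j].
- by rewrite /= (brZl LS) Y1X1 -kE /c big_ord0 scale1r.
- by rewrite [u 0]/= vX1.
- rewrite uS (jacE LS _ _ (ov _) X2) // IH (brZl LS) (symE LS _ Y1 X2) // XY //.
  rewrite oppr0 scaler0 (br0l LS) add0r.
  by case: eqP; rewrite ?(br0r LS) // (brZr LS) X2k scaler0.
- rewrite uS (jacE LS _ _ (ov _) X2) // IH (symE LS _ (ov _) X2) // X2v scaleNr opprK.
  rewrite (brZl LS) IH eqSS.
  have -> : br (X i2) (if j.+1 == i then c i *: k else 0) = 0.
    by case: eqP; rewrite ?(br0r LS) // (brZr LS) X2k scaler0.
  rewrite addr0; case: eqP => [->|_]; last by rewrite scaler0.
  by rewrite /c big_ord_recr /= scalerA mulrC.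
Qed.

Let fu n : br (Y i3) (u n) = 0.
Proof.
elim: n => [|n IH]; first exact: YX.
by rewrite uS (jacE LS _ _ Y3 X2) // IH YX // (br0l LS) (br0r LS) addr0.
Qed.

Let ve n : br (v n) (X i3) = 0.
Proof.
elim: n => [|n IH]; first by rewrite (brZl LS) YX // scaler0.
have := jacE LS (X i3) (erefl : false && true = false) Y2 (ov n).
by rewrite IH YX // !(br0r LS) addr0 => <-.
Qed.

(** The hypotheses make [br (u l) (u l)] a singular vector of degree 2l + 2. This is applied for [l]
    = 0 and 1 only; [ad X_2] applied to the resulting relations gives the mixed brackets. *)
Let uu_singular l : (forall j, br (br (Y j) (u l)) (u l) = 0) ->
  (forall j, br (u l) (br (Y j) (u l)) = 0) -> br (u l) (u l) = 0.
Proof.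
move=> Yl Yr.
pose la (w : 'rV[F]_m) := 2%:R * ((w *m alpha) 0 i1 + l%:R * (w *m alpha) 0 i2).
apply: (singular_vector0 charF0 HC (b := false) (la := la)).
- exact: (homog_br LS (ou l) (ou l)).
- move=> w; rewrite (jacE LS _ _ (hi w) (ou l)) // iota_u (brZl LS) (brZr LS).
  by rewrite -scalerDl; congr (_ *: _); rewrite /la; ring.
- move=> r ar; exists (l.*2).+1; rewrite /la ar !mxE mulr1.
  have -> : (l.*2).+2 = (2 * l + 2)%N by rewrite mul2n addn2.
  by rewrite natrD natrM mulrDr mulr1 addrC.
- by move=> j; rewrite (br_jac LS _ (homog_Y HC j) (ou l)) Yl Yr scaler0 addr0.
Qed.

Let u00 : br (u 0) (u 0) = 0.
Proof.
have E j : br (Y j) (u 0) = if j == i1 then h i1 else 0.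
  by case: eqP => [->|/eqP ?]; rewrite ?Y1X1 // YX.
have h1X : br (h i1) (u 0) = 0 by rewrite hX A11 scale0r.
apply: uu_singular => j; rewrite E; case: eqP => _; rewrite ?(br0l LS) ?(br0r LS) //.
by rewrite (symE LS _ (ou 0) (hi _)) // h1X oppr0.
Qed.

Let u01 : br (u 0) (u 1) = 0.
Proof.
have := br0r LS (X i2); rewrite -u00 (jacE LS _ _ X2 (ou 0)) // -uS.
rewrite (symO LS (ou 1) (ou 0)) -mulr2n -scaler_nat u00 => /eqP.
by rewrite scaler_eq0 (negPf two0) => /eqP.
Qed.

Let u11 : br (u 1) (u 1) = 0.
Proof.
have E j : br (Y j) (u 1) = if j == i2 then - b *: u 0 else 0.
  case: (cases j) => ->.
  - rewrite (negPf n12) uS (jacE LS _ _ Y1 X2) // YX // (br0l LS) add0r Y1X1.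
    by rewrite (symE LS _ X2 (hi _)) // hX A12 scale0r oppr0.
  - rewrite eqxx uS (jacE LS _ _ Y2 X2) // Y2X2 YX // (br0r LS) addr0 (brNl LS) hX A21.
    by rewrite scaleNr.
  - by rewrite (negPf n32) fu.
apply: uu_singular => j; rewrite E; case: eqP => _; rewrite ?(br0l LS) ?(br0r LS) //.
  by rewrite (brZl LS) u01 scaler0.
by rewrite (brZr LS) (symO LS (ou 1) (ou 0)) u01 scaler0.
Qed.

Let u02 : br (u 0) (u 2) = 0.
Proof.
have := br0r LS (X i2); rewrite -[in LHS]u01 (jacE LS _ _ X2 (ou 0)) // -!uS.
by rewrite u11 add0r.
Qed.

Let u12 : br (u 1) (u 2) = 0.
Proof.
have := br0r LS (X i2); rewrite -{1}u11 (jacE LS _ _ X2 (ou 1)) // -uS.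
rewrite (symO LS (ou 2) (ou 1)) -mulr2n -scaler_nat => /eqP.
by rewrite scaler_eq0 (negPf two0) => /eqP.
Qed.

Let uu i j : (i < 3)%N -> (j < 3)%N -> i != j -> br (u i) (u j) = 0.
Proof.
wlog ij : i j / (i < j)%N => [H hi' hj nij|].
  case: (ltngtP i j) nij => // ij _; first by apply: H; rewrite ?ltn_eqF.
  by rewrite (symO LS (ou i) (ou j)); apply: H; rewrite ?ltn_eqF.
by move: i j ij => [|[|[|i]]] [|[|[|j]]].
Qed.

Let ku n : br k (u n) = 0.
Proof. by rewrite iota_u !rowZE A11 A12 !mulr0 addr0 scale0r. Qed.

Let kv n : br k (v n) = 0.
Proof. by rewrite iota_v !rowZE A11 A12 !mulr0 addr0 oppr0 scale0r. Qed.

Let tu n : br (h i3) (u n) = - u n.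
Proof. by rewrite iota_u !rowE A31 A32 mulr0 addr0 scaleN1r. Qed.

Let tv n : br (h i3) (v n) = v n.
Proof. by rewrite iota_v !rowE A31 A32 mulr0 addr0 opprK scale1r. Qed.

Let ke : br k (X i3) = X i3.
Proof. by rewrite kE (brZl LS) hX scalerA mulVf ?scale1r. Qed.

Let kf : br k (Y i3) = - Y i3.
Proof. by rewrite kE (brZl LS) hY scalerA mulrN mulVf ?scaleN1r. Qed.

Let te : br (h i3) (X i3) = 2%:R *: X i3.
Proof. by rewrite hX A33. Qed.

Let tf : br (h i3) (Y i3) = - (2%:R *: Y i3).
Proof. by rewrite hY A33 scaleNr. Qed.

Let fe : br (Y i3) (X i3) = - h i3.
Proof. by rewrite (symE LS _ Y3 X3) // (br_X_Y HC) eqxx. Qed.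

Let sp i j := spinor br u (X i3) i j.
Let cs i j := cospinor br v (Y i3) i j.
Let H := k - 2%:R^-1 *: h i3.

Let cs_sp l n i j : (i < 3)%N -> (j < 3)%N -> (l < 3)%N -> (n < 3)%N ->
  (i < j)%N -> (l < n)%N ->
  br (cs l n) (sp i j) = if (l == i) && (n == j) then (- (2%:R * c i * c j)) *: H else 0.
Proof.
apply: (cospinor_spinor LS two0 ou ov Y3 (hi _) (hi _) _ uu fu ve ku tu ke fe) => *.
exact: vu.
Qed.

Let ex i j : homog par false (sp i j). Proof. exact: (homog_spinor LS ou X3). Qed.
Let ecs i j : homog par false (cs i j). Proof. exact: (homog_cospinor LS ov Y3). Qed.
Let eH : homog par false H.
Proof.
apply: (homogD LS); first exact: hi.
by rewrite -scaleN1r; do 2 apply: (homogZ LS); apply: hi.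
Qed.

Let Hsp i j : br H (sp i j) = sp i j.
Proof. exact: (weight_spinor LS ou (hi _) (hi _) ku tu ke te). Qed.
Let Hcs i j : br H (cs i j) = - cs i j.
Proof. exact: (weight_cospinor LS ov (hi _) (hi _) kv tv kf tf). Qed.

Let c_neq0 n : (n < 3)%N -> c n != 0.
Proof.
move=> n3; apply/prodf_neq0 => l _.
rewrite mulf_neq0 ?((pcharf0P F).1 charF0) //.
by case: l => [[|[|l]]] hl; rewrite ?addr0 //; have := leq_trans hl (n3 : (n <= 2)%N).
Qed.

Let cc_neq0 i j : (i < 3)%N -> (j < 3)%N -> - (2%:R * c i * c j) != 0.
Proof. by move=> hi' hj; rewrite oppr_eq0 !mulf_neq0 ?c_neq0. Qed.

Let H_neq0 : H != 0.
Proof.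
have -> : H = iota ((- 2%:R^-1) *: row i3 hv + (A i1 i3)^-1 *: row i1 hv).
  by rewrite (iota_lin HC) scaleNr addrC.
(* The first simple root takes the value 1/2 on [H], since a_11 = 0 and a_31 = -1. *)
apply/eqP => /(iota_inj0 HC) /(congr1 (fun w => (w *m alpha) 0 i1)).
rewrite mulmxDl mul0mx mxE !rowZE mxE A31 A11 mulr0 addr0 mulrNN mulr1.
by move/eqP; rewrite invr_eq0 (negPf two0).
Qed.

Let z_neq0 : sp 1 2 != 0.
Proof.
apply/eqP => E; have := @cs_sp 1 2 1 2 isT isT isT isT isT isT.
rewrite E (br0r LS) /= => /esym/eqP; rewrite scaler_eq0 (negPf H_neq0) orbF.
by rewrite (negPf (cc_neq0 _ _)).
Qed.

(** Normalized so that dual pairs bracket to exactly [H], as required of [f], [g] and [h] in the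
    independence result. *)
Let cc i j := (- (2%:R * c i * c j))^-1 *: cs i j.

Let cc_sp l n i j : (i < 3)%N -> (j < 3)%N -> (l < 3)%N -> (n < 3)%N ->
  (i < j)%N -> (l < n)%N ->
  br (cc l n) (sp i j) = if (l == i) && (n == j) then H else 0.
Proof.
move=> ??????; rewrite (brZl LS) cs_sp //; case: ifP => [/andP[/eqP-> /eqP->]|_].
  by rewrite scalerA mulVf ?scale1r ?cc_neq0.
by rewrite scaler0.
Qed.

Let Hcc i j : br H (cc i j) = - cc i j.
Proof. by rewrite (brZr LS) Hcs scalerN. Qed.

Let ecc i j : homog par false (cc i j).
Proof. exact: (homogZ LS). Qed.

Let word r := free_word br (sp 0 1) (sp 0 2) (sp 1 2) (block_word 0 r).

Let words_free (I : finType) (r : I -> seq bool) (n : nat) (a : I -> F) :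
  injective r -> (forall i, size (r i) = n) ->
  \sum_i a i *: word (r i) = 0 -> forall i, a i = 0.
Proof.
by apply: (block_words_free LS charF0 (ex 0 1) (ex 0 2) (ecc 0 1) (ecc 0 2) eH) => //;
  rewrite cc_sp.
Qed.

Let pd_sp i j : princ_deg br iota X Y (i + j + 3)%N (sp i j).
Proof.
apply: princ_deg_spinor; last exact: pd_X.
elim=> [|n IH]; first exact: pd_X.
exact: princ_deg_eq (pd_br (pd_X _ _ _ _ i2) IH).
Qed.

(** The 2^n words with n blocks are independent and share one degree quadratic in n, so a polynomial
    bound fails for large n. *)
Lemma infinite_growth (C d : nat) :
  ~ forall l : int, span_dim_le (princ_deg br iota X Y l) (C * (absz l + 1) ^ d)%N.
Proof.
have [n hn] := poly_lt_exp2 C d.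
move=> /(_ (6 + 32 * n ^ 2 + 2 * n)%N).
set N := (C * _)%N; have {}hn : (N < 2 ^ n)%N by [].
have cardE : #|{: n.-tuple bool}| = (2 ^ n)%N by rewrite card_tuple card_bool.
have leN : (N.+1 <= #|{: n.-tuple bool}|)%N by rewrite cardE.
pose r (i : 'I_N.+1) : seq bool := enum_val (widen_ord leN i) : n.-tuple bool.
have rI : injective r.
  by move=> i j /val_inj/enum_val_inj/(congr1 val) /= ?; apply: val_inj.
have sz i : size (r i) = n by rewrite /r size_tuple.
move=> /(_ (fun i => word (r i))) [] => [i|a [[i ai] E]].
  have := princ_deg_block_word 0 (r i) (pd_sp 0 1) (pd_sp 0 2) (pd_sp 1 2).
  by rewrite sz muln0 mul0n addn0.
by move: ai; rewrite (words_free rI sz E) eqxx.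
Qed.

End InfiniteGrowth.

(** * Odd reflections up to reordering and row scaling *)

Section ScaleInvariance.
Variables (F : fieldType) (n : nat) (A : 'M[F]_n) (p : 'I_n -> bool).
Hypothesis two0 : 2%:R != 0 :> F.

(** Working modulo row scaling avoids the diagonal normalization of [odd_refl]: a reflected matrix
    may be given in any scaling. *)
Definition reachable_upto (B : 'M[F]_n) (q : 'I_n -> bool) : Prop :=
  exists D q', reachable A p D q' /\ equiv_reorder_rescale D q' B q.

Lemma reachable_upto_equiv B q : equiv_reorder_rescale A p B q -> reachable_upto B q.
Proof. by move=> E; exists A, p; split=> //; apply: reach_refl. Qed.

(** Row k of the reflection is homogeneous in row k, rows not linked to k are unchanged, and every
    other row i is bilinear in rows i and k; this dictates the three factors. *)
Lemma oref_raw_rescale (D B : 'M[F]_n) (s : 'S_n) (c : 'I_n -> F) k :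
  (forall i, c i != 0) -> (forall i j, B i j = c i * D (s i) (s j)) ->
  exists2 r : 'I_n -> F, forall i, r i != 0 &
    forall i j, oref_raw B k i j = r i * oref_raw D (s k) (s i) (s j).
Proof.
move=> c0 BD.
exists (fun i => if i == k then c k else
  if (D (s i) (s k) == 0) && (D (s k) (s i) == 0) then c i else c i * c k).
  by move=> i; do 2 case: ifP => // _; rewrite mulf_neq0.
have B0 i j : (B i j == 0) = (D (s i) (s j) == 0).
  by rewrite BD mulf_eq0 (negPf (c0 i)).
move=> i j; rewrite !mxE !(inj_eq perm_inj) !B0.
have [ik|ik] := eqVneq i k; first by rewrite BD.
have [jk|jk] := eqVneq j k.
  case: ifP => [/andP[/eqP e1 /eqP e2]|_]; rewrite !BD ?e1 ?e2.
    by rewrite !mulr0 oppr0 mulr0.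
  by ring.
case: ifP => _; first exact: BD.
by case: ifP => _; rewrite !BD; ring.
Qed.

Lemma reachable_upto_step B q k (B' : 'M[F]_n) (q' : 'I_n -> bool) (c : 'I_n -> F) :
  reachable_upto B q -> B k k = 0 -> q k -> (forall i, c i != 0) ->
  (forall i j, c i * B' i j = oref_raw B k i j) ->
  (forall i, q' i = odd_refl_par B q k i) -> reachable_upto B' q'.
Proof.
move=> [D [q1 [reachD [s [d [d0 BD qq]]]]]] Bkk qk c0 EB' Eq'.
have D0 i j : (B i j == 0) = (D (s i) (s j) == 0).
  by rewrite BD mulf_eq0 (negPf (d0 i)).
exists (odd_refl D (s k)), (odd_refl_par D q1 (s k)); split.
  apply: reach_step reachD _; split; last by rewrite -qq.
  by apply/eqP; rewrite -D0 Bkk.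
have [r r0 Er] := @oref_raw_rescale D B s d k d0 BD.
pose x i := oref_raw D (s k) (s i) (s i).
pose m i := if x i == 0 then 1 else 2%:R / x i.
have m0 i : m i != 0.
  rewrite /m; case: ifP => [_|/negbT x0]; first exact: oner_neq0.
  by rewrite mulf_neq0 ?invr_eq0.
exists s, (fun i => (c i)^-1 * (r i / m i)); split.
- by move=> i; rewrite !mulf_neq0 ?invr_eq0.
- move=> i j; have -> : odd_refl D (s k) (s i) (s j) = m i * oref_raw D (s k) (s i) (s j).
    by rewrite mxE /m /x; case: ifP => _; rewrite ?mul1r.
  rewrite -[LHS](mulKf (c0 i)) EB' Er; move: (m0 i) (c0 i).
  by move: (m i) (c i) => mi ci mi0 ci0; field; rewrite mi0.
- move=> i; rewrite Eq' /odd_refl_par (inj_eq perm_inj) !D0.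
  by case: ifP => // _; case: ifP => // _; rewrite qq.
Qed.

Hypothesis admA : admissible A p.

Lemma reachable_upto_odd B q i : reachable_upto B q -> B i i = 0 -> q i.
Proof.
move=> [D [q' [/(proj2 admA)[_ h2 _ _] [s [c [c0 BD ->]]]]]] /eqP.
by rewrite BD mulf_eq0 (negPf (c0 i)) => /eqP/h2.
Qed.

(** (C3) multiplied through by the diagonal entry, a form invariant under row scaling. *)
Lemma reachable_upto_nonpos B q i j : reachable_upto B q -> B i i != 0 -> j != i ->
  exists z : nat, 2%:R * B i j = - (2 ^ (q i : nat) * z)%N%:R * B i i.
Proof.
move=> [D [q' [/(proj2 admA)[h1 _ h3 _] [s [c [c0 BD qq]]]]]] Bii ji.
have [e|e] := h1 (s i); first by move: Bii; rewrite BD e mulr0 eqxx.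
have [|z Ez] := h3 _ e (s j); first by rewrite (inj_eq perm_inj).
by exists z; rewrite !BD e Ez qq; ring.
Qed.

Lemma reachable_upto_C4 B q i j : reachable_upto B q ->
  B i j = 0 -> B j i != 0 -> B i i = 0.
Proof.
move=> [D [q' [/(proj2 admA)[_ _ _ h4] [s [c [c0 BD _]]]]]].
rewrite !BD mulf_eq0 negb_or => /eqP; rewrite mulf_eq0 (negPf (c0 i)) => /eqP e.
by case/andP => _ /(h4 _ _ e) ->; rewrite mulr0.
Qed.

End ScaleInvariance.

(** * Integrality conditions on integer matrices *)

Definition zentry (l : seq (seq int)) (i j : nat) : int := nth 0 (nth [::] l i) j.

Definition zmx (F : fieldType) (l : seq (seq int)) : 'M[F]_3 :=
  \matrix_(i < 3, j < 3) (zentry l i j)%:~R.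

(** Integer version of [oref_raw], so that reflections are verified by integer arithmetic. *)
Definition zoref (l : seq (seq int)) (k i j : nat) : int :=
  let a := zentry l in
  if i == k then a k j
  else if j == k then - (a k i * a i k)
  else if (a i k == 0) && (a k i == 0) then a i j
  else if (a k j == 0) && (a j k == 0) then a k i * a i j
  else a k i * a i j + a k j * a i k + a k i * a i k.

Section IntegerMatrices.
Variables (F : fieldType) (A : 'M[F]_3) (p : 'I_3 -> bool).
Hypothesis charF0 : [pchar F] =i pred0.
Hypothesis admA : admissible A p.

Definition zreachable (l : seq (seq int)) (q : seq bool) : Prop :=
  reachable_upto A p (zmx F l) (par3 q).

Let two0 : 2%:R != 0 :> F.
Proof. by rewrite ((pcharf0P F).1 charF0). Qed.

Let intF_eq0 (a : int) : (a%:~R == 0 :> F) = (a == 0).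
Proof.
by case: a => a; rewrite ?NegzE ?rmorphN ?oppr_eq0 /= -pmulrn ((pcharf0P F).1 charF0).
Qed.

Let intF_inj (a b : int) : a%:~R = b%:~R :> F -> a = b.
Proof.
by move=> /eqP; rewrite -subr_eq0 -rmorphB intF_eq0 subr_eq0 => /eqP.
Qed.

Let oref_zmx l (k i j : 'I_3) : oref_raw (zmx F l) k i j = (zoref l k i j)%:~R.
Proof.
rewrite !mxE /zoref -!(inj_eq val_inj) /= !intF_eq0.
by do ![case: ifP => _] => //; rewrite ?rmorphN ?rmorphD ?rmorphM.
Qed.

(** The factors [c] allow common divisors of the rows to be removed after a reflection. *)
Lemma zreachable_step l q (k : 'I_3) (l' : seq (seq int)) q' (c : nat -> int) :
  zreachable l q -> zentry l k k = 0 -> nth false q k ->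
  (forall i, c i != 0) ->
  (forall i j, (i < 3)%N -> (j < 3)%N -> c i * zentry l' i j = zoref l k i j) ->
  (forall i, (i < 3)%N -> nth false q' i =
     if i == k then true
     else if (zentry l i k != 0) || (zentry l k i != 0) then ~~ nth false q i
     else nth false q i) ->
  zreachable l' q'.
Proof.
move=> R lkk qk c0 El' Eq'.
apply: (reachable_upto_step two0 (c := fun i => (c i)%:~R) R (k := k)) => //.
- by rewrite mxE lkk.
- by move=> i; rewrite intF_eq0.
- by move=> i j; rewrite oref_zmx -El' // rmorphM mxE.
- move=> i; rewrite [LHS]Eq' // /odd_refl_par !mxE !intF_eq0.
  by rewrite -(inj_eq val_inj).
Qed.

Lemma zreachable_nonpos l q (i j : 'I_3) :
  zreachable l q -> zentry l i i != 0 -> j != i ->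
  exists z : nat, 2%:Z * zentry l i j =
    - ((2 ^ (nth false q i : nat) * z)%N : int) * zentry l i i.
Proof.
move=> R e ji; have := reachable_upto_nonpos admA R (i := i) (j := j).
rewrite !mxE intF_eq0 => /(_ e ji)[z Ez]; exists z.
by apply: intF_inj; rewrite mulNr rmorphN !rmorphM /= Ez mulNr natrM.
Qed.

Lemma zreachable_C4 l q (i j : 'I_3) :
  zreachable l q -> zentry l i j = 0 -> zentry l j i != 0 -> zentry l i i = 0.
Proof.
move=> R e e'; have := reachable_upto_C4 admA R (i := i) (j := j).
by rewrite !mxE e intF_eq0 => /(_ erefl e')/eqP; rewrite intF_eq0 => /eqP.
Qed.

Let o0 : 'I_3 := ord0.
Let o1 : 'I_3 := @Ordinal 3 1 isT.
Let o2 : 'I_3 := @Ordinal 3 2 isT.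

Ltac check_zoref :=
  case=> [|[|[|//]]] [|[|[|//]]] _ _; rewrite /zoref /zentry /=;
  do ?[case: ifP => ?]; nia.

Ltac check_parity :=
  case=> [|[|[|//]]] _; rewrite /zentry /=; do ?[case: ifP => ?]; nia.

Lemma zreachable_S b c e :
  zreachable [:: [:: 0; 0; 1]; [:: - b%:Z; 2; - c%:Z]; [:: 1; - e%:Z; 0]]
    [:: true; false; true] ->
  (0 < b)%N -> (0 < e)%N -> [/\ b = 1, c = 1 & e = 2]%N.
Proof.
move=> R b0 e0.
have c0 : (0 < c)%N.
  case: (posnP c) => // c0; have := zreachable_C4 (i := o1) (j := o2) R.
  rewrite /zentry /= c0 => /(_ erefl); rewrite oppr_eq0; lia.
have e2 : (1 < e)%N.
  have R0 : zreachable [:: [:: 0; 0; 1]; [:: 0; 0; - b%:Z]; [:: -1; 1 - e%:Z; 2]]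
     [:: true; true; false].
    by apply: (zreachable_step (c := fun=> 1) (k := o0) R) => //; [check_zoref|check_parity].
  (* For e = 1 the last row has a zero opposite the nonzero entry [- b], while its diagonal entry is
     2, against (C4). *)
  rewrite ltn_neqAle e0 andbT; apply/negP => /eqP e1.
  have := zreachable_C4 (i := o2) (j := o1) R0.
  rewrite /zentry /= -e1 => /(_ erefl); lia.
have R2 : zreachable [:: [:: 2; 1 - e%:Z; -1];
    [:: e%:Z * b - c%:Z + e%:Z * c; 2%:Z * e * (c%:Z - 1); - (e%:Z * c)];
    [:: 1; - e%:Z; 0]] [:: false; true; true].
  by apply: (zreachable_step (c := fun=> 1) (k := o2) R) => //; [check_zoref|check_parity].
(* For c > 1 the middle row has a positive diagonal entry and a positive first entry, against
   (C3). *)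
have c1 : c = 1%N.
  apply/eqP; rewrite eqn_leq c0 andbT leqNgt; apply/negP => c1.
  have [||z Ez] := zreachable_nonpos (i := o1) (j := o0) R2 => //.
    by rewrite /zentry /=; nia.
  by move: Ez; rewrite /zentry /=; nia.
subst c.
have R12 : zreachable [:: [:: 2%:Z * (e%:Z * b + e%:Z - 1) * (2%:Z - e%:Z);
       (e%:Z * b + e%:Z - 1) * (e%:Z - 1);
       e%:Z * (e%:Z - 1) - e%:Z * (e%:Z * b + e%:Z - 1)];
    [:: e%:Z * b + e%:Z - 1; 0; - e%:Z];
    [:: - (e%:Z * b); - e%:Z; 2%:Z * e]] [:: true; true; false].
  apply: (zreachable_step (c := fun i => if i == 2%N then e%:Z else 1) (k := o1) R2) => //.
  - by rewrite /zentry /=; ring.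
  - by move=> i; case: ifP => // _; lia.
  - check_zoref.
  - check_parity.
(* Index [o0] is odd in [R12], so for e > 2 condition (C3) makes e - 1 an even multiple of e - 2,
   hence e = 3; the entry in column [o2] then has the wrong sign. *)
have {e0}e2 : e = 2%N.
  apply/eqP; rewrite eqn_leq e2 andbT leqNgt; apply/negP => e3.
  have [||z Ez] := zreachable_nonpos (i := o0) (j := o1) R12 => //.
    by rewrite /zentry /=; nia.
  have [||z' Ez'] := zreachable_nonpos (i := o0) (j := o2) R12 => //.
    by rewrite /zentry /=; nia.
  move: Ez Ez'; rewrite /zentry /=.
  have f0 : (0 < e * b + e - 1)%N by nia.
  have -> : e%:Z * b + e%:Z - 1 = (e * b + e - 1)%N by lia.
  have fE : (e * b + e - 1 >= e + e - 1)%N by nia.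
  move: (e * b + e - 1)%N f0 fE => f f0 fE Ez Ez'.
  have ez : e%:Z - 1 = 2%:Z * z * (e%:Z - 2%:Z) by nia.
  have e3' : e = 3 by nia.
  by move: Ez' fE; rewrite e3'; nia.
subst e.
have R012 : zreachable [:: [:: 0; 2%:Z * b + 1; - (4%:Z * b)];
    [:: - (2%:Z * b + 1); 2%:Z * (2%:Z * b + 1); - (2%:Z * b + 1)];
    [:: - (4%:Z * b * b); 2%:Z * b * b + 3%:Z * b; 8%:Z * b * (b%:Z - 1)]]
    [:: true; false; true].
  apply: (zreachable_step (c := fun i => if i == 1%N then 2%:Z * b + 1 else
      if i == 0%N then 1 else 2%:Z) (k := o0) R12) => //.
  - by rewrite /zentry /=; ring.
  - by move=> i; case: ifP => [_|_]; [lia|case: ifP].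
  - check_zoref.
  - check_parity.
(* For b > 1 the last row of [R012] has a positive diagonal entry and a positive middle entry. *)
split=> //; apply/eqP; rewrite eqn_leq b0 andbT leqNgt; apply/negP => b2.
have [||z Ez] := zreachable_nonpos (i := o2) (j := o1) R012 => //.
  by rewrite /zentry /=; nia.
by move: Ez; rewrite /zentry /=; nia.
Qed.

Lemma zreachable_D b c d e (q2 : bool) :
  zreachable [:: [:: 0; 0; 1]; [:: - b%:Z; 2; - c%:Z];
                 [:: - (2 ^ q2 * d)%N%:Z; - (2 ^ q2 * e)%N%:Z; 2]]
    [:: true; false; q2] ->
  (0 < b)%N -> (0 < d)%N -> [/\ c = 0, d = 1, e = 0 & q2 = false]%N.
Proof.
move=> R b0 d0.
have R0 : zreachable [:: [:: 0; 0; 1]; [:: 0; 0; - b%:Z];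
    [:: (2 ^ q2 * d)%N%:Z; - (2 ^ q2 * e)%N%:Z - (2 ^ q2 * d)%N%:Z;
        2%:Z - 2%:Z * (2 ^ q2 * d)%N]] [:: true; true; ~~ q2].
  have : (0 < 2 ^ q2 * d)%N by rewrite muln_gt0 expn_gt0.
  move: (2 ^ q2 * d)%N (2 ^ q2 * e)%N R => d' e' R d'0.
  by apply: (zreachable_step (c := fun=> 1) (k := o0) R) => //; [check_zoref|check_parity].
(* If this product exceeds 1, the last row of [R0] has a negative diagonal entry and a negative
   middle entry, against (C3). *)
have d1 : (2 ^ q2 * d = 1)%N.
  have : (0 < 2 ^ q2 * d)%N by rewrite muln_gt0 expn_gt0.
  move: (2 ^ q2 * d)%N (2 ^ q2 * e)%N R0 => d' e' R0 d'0.
  apply/eqP; rewrite eqn_leq d'0 andbT leqNgt; apply/negP => d2.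
  have [||z Ez] := zreachable_nonpos (i := o2) (j := o1) R0 => //.
    by rewrite /zentry /=; nia.
  by move: Ez; rewrite /zentry /=; nia.
have q2F : q2 = false by case: (q2) d1 => //; rewrite -[nat_of_bool true]/1%N expn1; lia.
move: R R0 d1; rewrite q2F !mul1n => R R0 d1; subst d.
(* Now [o2] is isotropic in [R0]. After reflecting there the middle row has a positive diagonal
   entry, so its first entry [e * b] cannot be positive. *)
have e_eq0 : e = 0%N.
  have R20 : zreachable [:: [:: 2; - e%:Z; -1];
      [:: e%:Z * b; 2%:Z * b * (e%:Z + 1); - (b%:Z * (e%:Z + 1))];
      [:: 1; - e%:Z - 1; 0]] [:: false; false; true].
    by apply: (zreachable_step (c := fun=> 1) (k := o2) R0) => //; [check_zoref|check_parity].
  have [||z Ez] := zreachable_nonpos (i := o1) (j := o0) R20 => //.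
    by rewrite /zentry /=; nia.
  by move: Ez; rewrite /zentry /=; nia.
subst e; split=> //; apply/eqP; rewrite -leqn0 leqNgt; apply/negP => c0.
have := zreachable_C4 (i := o2) (j := o1) R.
by rewrite /zentry /= => /(_ erefl); lia.
Qed.

End IntegerMatrices.

(** * Reduction to the two normal forms *)

Lemma equiv_reorder_rescale_perm (F : fieldType) n (A : 'M[F]_n) p (s : 'S_n) (B : 'M[F]_n) q
  (c : 'I_n -> F) : (forall i, c i != 0) ->
  (forall i j, B i j = c i * A (s i) (s j)) -> (forall i, q i = p (s i)) ->
  equiv_reorder_rescale A p B q.
Proof. by move=> *; exists s, c. Qed.

Lemma perm3_of_pair (k j : 'I_3) : j != k ->
  exists s : 'S_3, s ord0 = k /\ s (@Ordinal 3 1 isT) = j.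
Proof.
move=> jk; pose t := tperm ord0 k; pose o1 := @Ordinal 3 1 isT.
have tj : t j != ord0 by rewrite -(tpermR ord0 k : t k = ord0) (inj_eq perm_inj).
exists (tperm o1 (t j) * t)%g; rewrite !permM; split.
  by rewrite (@tpermD _ o1 (t j) ord0) // /t tpermL.
by rewrite tpermL /t tpermK.
Qed.

Lemma no_finite_growth (F : fieldType) (charF0 : [pchar F] =i pred0) (A : 'M[F]_3) p
  (s : 'S_3) (t : F) (b : nat) : t != 0 -> (1 < b)%N ->
  (forall i j, A (s i) (s j) =
     (if i == ord0 then t else 1) *
     zmx F [:: [:: 0; 0; 1]; [:: - b%:Z; 2; 0]; [:: -1; 0; 2]] i j) ->
  (forall i, p (s i) = par3 [:: true; false; false] i) ->
  ~ contragredient_finite_growth A p.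
Proof.
move=> t0 b1 As ps [m [alpha [hv [L [br [par [iota [X [Y [HC [C [d fg]]]]]]]]]]]].
pose o1 := @Ordinal 3 1 isT; pose o2 := @Ordinal 3 2 isT.
have n0 l : l.+1%:R != 0 :> F by rewrite ((pcharf0P F).1 charF0).
apply: (infinite_growth charF0 HC (i1 := s ord0) (i2 := s o1) (i3 := s o2)
  (b := - b%:R) _ _ _ _ _ _ _ _ _ _ _ _ _ _ _ _ fg);
  rewrite ?(inj_eq perm_inj) ?ps ?As ?mxE ?mulr1 ?mulr0 ?mul1r //=.
- by rewrite rmorphN.
- by rewrite oppr_eq0; case: b b1 {As} => // b.
(* The entry a_21 is [- b], so the condition a_21 + 1 != 0 says that b is not 1. *)
- case: b b1 {As} => [|[|b]] // _.
  by rewrite -natr1 opprD subrK oppr_eq0.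
Qed.

Theorem theorem7p1 (F : closedFieldType) (charF0 : [pchar F] =i pred0)
  (A : 'M[F]_3) (p : 'I_3 -> bool) :
  indecomposable A -> elemental A -> admissible A p ->
  (exists k, singular_isotropic A p k) ->
  contragredient_finite_growth A p ->
  equiv_reorder_rescale A p (S120 F) pS120 \/
  equiv_reorder_rescale A p (D210 F) pD210.
Proof.
move=> _ elA admA [k [[Akk pk] [j [jk Akj Ajk]]]] growth.
have two0 : 2%:R != 0 :> F by rewrite ((pcharf0P F).1 charF0).
have [s [s0 s1]] := perm3_of_pair jk.
pose o0 : 'I_3 := ord0; pose o1 := @Ordinal 3 1 isT; pose o2 := @Ordinal 3 2 isT.
pose B : 'M[F]_3 := \matrix_(i, j) A (s i) (s j); pose q i := p (s i).
have BE i l : B i l = A (s i) (s l) by rewrite mxE.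
move: B BE => B BE.
have ord3 (P : 'I_3 -> Prop) : P o0 -> P o1 -> P o2 -> forall i, P i.
  move=> P0 P1 P2 [[|[|[|//]]] hi]; [move: P0|move: P1|move: P2];
    by congr (P _); apply: val_inj.
have RB : reachable_upto A p B q.
  apply/reachable_upto_equiv/(equiv_reorder_rescale_perm (s := s) (c := fun=> 1)) => //.
    by move=> _; apply: oner_neq0.
  by move=> i l; rewrite BE mul1r.
have B00 : B o0 o0 = 0 by rewrite BE s0.
have B01 : B o0 o1 = 0 by rewrite BE s0 s1.
have B10 : B o1 o0 != 0 by rewrite BE s0 s1.
have q0 : q o0 = true by rewrite /q s0.
(* The row of [k] is nonzero, and its third entry is the only one left. *)
have B02 : B o0 o2 != 0.
  have [l Akl] := elA k; rewrite -s0 -(permKV s l) in Akl.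
  move: Akl; elim/ord3: (s^-1%g l) => //; rewrite ?s0 ?s1 ?Akk ?Akj ?eqxx //.
  by rewrite BE s0.
have Bdiag i : B i i = 0 \/ B i i = 2%:R by rewrite BE; apply: (proj1 admA).
have [RB' B'E] : reachable_upto A p (oref_raw B o0) (odd_refl_par B q o0) /\
   [/\ oref_raw B o0 o1 o1 = 0,
       oref_raw B o0 o2 o1 = B o0 o2 * (B o2 o1 + B o2 o0) &
       oref_raw B o0 o2 o2 = B o0 o2 * (B o2 o2 + 2%:R * B o2 o0)].
  split.
    apply: (reachable_upto_step two0 (c := fun=> 1) RB B00) => //.
      by move=> _; apply: oner_neq0.
    by move=> *; rewrite mul1r.
  by split; rewrite mxE /= ?B01 ?(negPf B10) ?(negPf B02) ?andbF /=; ring.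
have [B'11 B'21 B'22] := B'E.
(* After reflection at [o0] the diagonal entry at [o1] vanishes, so [o1] is odd there; the
   reflection flipped its parity because [B o1 o0] is nonzero. *)
have q1 : q o1 = false.
  have := reachable_upto_odd admA RB' B'11.
  by rewrite /odd_refl_par /= B10 /= => /negbTE.
have B11 : B o1 o1 = 2%:R.
  by case: (Bdiag o1) => // /(reachable_upto_odd admA RB); rewrite q1.
have nonpos i l : B i i = 2%:R -> l != i ->
    exists z : nat, B i l = - (2 ^ (q i : nat) * z)%N%:R.
  move=> Bii li; have [||z Ez] := reachable_upto_nonpos admA RB (i := i) (j := l) => //.
    by rewrite Bii.
  by exists z; apply: (mulfI two0); rewrite Ez Bii mulrC.
have [//|b Eb] := nonpos o1 o0 B11 _; have [//|c Ec] := nonpos o1 o2 B11 _.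
rewrite q1 mul1n in Eb; rewrite q1 mul1n in Ec.
have b0 : (0 < b)%N by rewrite lt0n; apply/eqP => e; rewrite Eb e oppr0 eqxx in B10.
have equivZ (d : 'I_3 -> F) l r : (forall i, d i != 0) ->
  (forall i j, B i j = d i * zmx F l i j) -> (forall i, q i = par3 r i) ->
  equiv_reorder_rescale A p (zmx F l) (par3 r).
  move=> d0 Bd qr; apply: (equiv_reorder_rescale_perm (s := s) (c := fun i => (d i)^-1)).
  - by move=> i; rewrite invr_eq0.
  - by move=> i l'; have := Bd i l'; rewrite BE => ->; rewrite mulKf.
  - by move=> i; rewrite -qr.
have S120E : S120 F = zmx F [:: [:: 0; 0; 1]; [:: -1; 2; -1]; [:: 1; -2; 0]].
  by apply/matrixP; elim/ord3; elim/ord3; rewrite !mxE.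
have D210E : D210 F = zmx F [:: [:: 0; 0; 1]; [:: -1; 2; 0]; [:: -1; 0; 2]].
  by apply/matrixP; elim/ord3; elim/ord3; rewrite !mxE.
have [B22|B22] := Bdiag o2; [left|right].
- have q2 : q o2 = true by apply: (reachable_upto_odd admA RB).
  have B'22_neq0 : oref_raw B o0 o2 o2 != 0.
    apply/eqP => /(reachable_upto_odd admA RB').
    by rewrite /odd_refl_par /= B02 orbT q2.
  have B20 : B o2 o0 != 0.
    by apply: contraNneq B'22_neq0 => e; rewrite B'22 B22 e mulr0 addr0 mulr0.
  have [//|z Ez] := reachable_upto_nonpos admA RB' (i := o2) (j := o1) B'22_neq0.
  (* (C3) after the reflection gives B21 + B20 = - z B20. The successor records that the integer e
     of the normal form is positive. *)
  have B21 : B o2 o1 = - (z.+1)%:R * B o2 o0.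
    move: Ez; rewrite B'21 B'22 B22 /odd_refl_par /= B02 orbT q2 mul1n add0r => Ez.
    apply: (addIr (B o2 o0)); apply: (mulfI B02); apply: (mulfI two0).
    by rewrite Ez -natr1; ring.
  pose d i := if i == o0 then B o0 o2 else if i == o1 then 1 else B o2 o0.
  have d0 i : d i != 0 by rewrite /d; do 2 case: ifP => // _; apply: oner_neq0.
  have E : equiv_reorder_rescale A p
      (zmx F [:: [:: 0; 0; 1]; [:: - b%:Z; 2; - c%:Z]; [:: 1; - (z.+1)%:Z; 0]])
      (par3 [:: true; false; true]).
    apply: (equivZ d) => //; last by elim/ord3.
    elim/ord3; elim/ord3; rewrite mxE /d /= ?(B00, B01, B11, B22, Eb, Ec, B21)
      ?rmorphN ?mulr0 ?mulr1 ?mul1r //.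
    by rewrite mulrC; congr (_ * - _).
  have [//|eb ec ez] := zreachable_S charF0 admA (reachable_upto_equiv E) b0 _.
  by rewrite S120E; move: E; rewrite eb ec ez.
- have [//|d Ed] := nonpos o2 o0 B22 _; have [//|e Ee] := nonpos o2 o1 B22 _.
  (* By (C4), d = 0 would contradict [B02], since the diagonal entry is 2. *)
  have d0 : (0 < d)%N.
    rewrite lt0n; apply/eqP => e0; have := reachable_upto_C4 admA RB (i := o2) (j := o0).
    by rewrite Ed e0 muln0 oppr0 => /(_ erefl B02)/eqP; rewrite B22 (negPf two0).
  pose t i := if i == o0 then B o0 o2 else 1.
  have t0 i : t i != 0 by rewrite /t; case: ifP => // _; apply: oner_neq0.
  pose l := [:: [:: 0; 0; 1]; [:: - b%:Z; 2; - c%:Z];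
                 [:: - (2 ^ q o2 * d)%N%:Z; - (2 ^ q o2 * e)%N%:Z; 2]].
  have Bl i j' : B i j' = t i * zmx F l i j'.
    by elim/ord3: i; elim/ord3: j'; rewrite mxE /t /= ?(B00, B01, B11, B22, Eb, Ec, Ed, Ee)
      ?rmorphN ?mulr0 ?mulr1 ?mul1r.
  have qr i : q i = par3 [:: true; false; q o2] i by elim/ord3: i.
  have E := equivZ t l _ t0 Bl qr.
  have [c0 d1 e0 q2] := zreachable_D charF0 admA (reachable_upto_equiv E) b0 d0.
  move: E Bl qr; rewrite /l q2 c0 d1 e0 => E Bl qr.
  (* The reflections used leave b free; finite growth excludes every value other than 1. *)
  have [b1|b1] := eqVneq b 1%N; first by rewrite D210E; move: E; rewrite b1.
  case: (no_finite_growth charF0 (s := s) (t := B o0 o2) (b := b) B02 _ _ _ growth).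
  - by rewrite ltn_neqAle eq_sym b1 b0.
  - by move=> i j'; rewrite -BE Bl.
  - by move=> i; rewrite -qr.
Qed.
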